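(* Suppose that $n-m_0+\ell_0\ge 0$. Let $K_0$ be a perfect subfield of $K$, let $f(x)\in K_0[x]$ be a degree $n$ polynomial without repeated roots, and let $\mathcal P\in \mathcal C_{f,d}(K_0)$. Then $\mathcal P$ has order $m_0$ if and only if there exists a degree $n$ polynomial $\tilde f(x)\in K_0[x]$ without repeated roots that enjoys the following properties. (i) There exist a nonzero $\tilde B\in K_0$ and a degree $\ell_0$ polynomial $w(x)\in K_0[x]$ with leading coefficient $\tilde B$ such that $w(0)=1$ and $\tilde f(x)=-\tilde B^d x^{m_0}+w(x)^d$. (ii) There is a nonzero polynomial $\tilde q(x)\in K_0[x]$ of degree $n-m_0+\ell_0$ such that $\tilde q(0)=1$ and $w(x)=\tilde B x^{\ell_0}+\tilde q(x)$ (with $\tilde B$, $w$ as in (i)). (iii) There is an isomorphism of algebraic $K_0$-curves $\mathcal C_{f,d}\to\mathcal C_{\tilde f,d}$ under which $\mathcal O_{f,d}$ goes to $\mathcal O_{\tilde f,d}$ and $\mathcal P$ goes to $\mathcal Q=(0,1)\in\mathcal C_{\tilde f,d}(K_0)$. If this is the case, then $\mathcal Q=(0,1)$ is a $K_0$-point of order $m_0$ on $\mathcal C_{\tilde f,d}$.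
   Context: $K$ is an algebraically closed field; $n,d$ are integers with $2\le d<n$, $\gcd(n,d)=1$, $\mathrm{char}(K)\nmid d$. Put $\ell_0:=[(n+d)/d]$ (integer part) and $m_0:=d\ell_0$. For a degree $n$ polynomial $f(x)\in K[x]$ without repeated roots, $\mathcal C_{f,d}$ is the smooth projective model of the smooth plane affine curve $y^d=f(x)$, and $\mathcal O_{f,d}$ is its unique point at infinity. If $f(x)\in K_0[x]$ for a perfect subfield $K_0\subset K$, then $\mathcal C_{f,d}$ is viewed as a curve over $K_0$, and $\mathcal O_{f,d}$ is a $K_0$-point. The curve $\mathcal C_{f,d}$ is identified with its image in its Jacobian $J(\mathcal C_{f,d})$ under the embedding sending $\mathcal O_{f,d}$ to $0$; a point of $\mathcal C_{f,d}$ has order $m$ if its image in $J(\mathcal C_{f,d})$ has order $m$. *)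

(* Defs.v *)
From HB Require Import structures.
From mathcomp Require Import all_boot all_order all_algebra all_field.
From mathcomp Require Import fraction qpoly qfpoly ring_quotient.
From mathcomp Require Import boolp.
From mathcomp.multinomials Require Import freeg.

Set Implicit Arguments.
Unset Strict Implicit.
Unset Printing Implicit Defensive.

Import Order.TTheory GRing.Theory Num.Theory.

Local Open Scope ring_scope.

Local Notation tofrac := (@FracField.tofrac _).

Definition perfect_field (k : fieldType) : Prop :=
  forall p : {poly k}, irreducible_poly p -> separable_poly p.

Definition has_order (V : zmodType) (x : V) (m : nat) : Prop :=
  [/\ (0 < m)%N, x *+ m = 0 & forall i, (0 < i < m)%N -> x *+ i != 0].

(* The smooth projective curve with function field L over k is the abstract   *)
(* nonsingular curve of L: its points are the normalized discrete valuations  *)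
(* of L that are trivial on the constants, embedded in L by cst. Although L   *)
(* is meant to be a field, only its units are used.                           *)

Section Points.
Variables (k : fieldType) (L : comUnitRingType) (cst : k -> L).

(* The value 0 of ord at 0 (in place of +oo) is a convention which makes ord  *)
(* depend only on the valuation; the order of 0 is never used.                *)
Record place := Place {
  ord : L -> int;
  ord0 : ord 0 = 0;
  ordM : forall g h, g != 0 -> h != 0 -> ord (g * h) = ord g + ord h;
  ordD : forall g h, g != 0 -> h != 0 -> g + h != 0 ->
    Num.min (ord g) (ord h) <= ord (g + h);
  ord_cst : forall c : k, c != 0 -> ord (cst c) = 0;
  ord_normalized : exists g, ord g = 1
}.

HB.instance Definition _ := gen_eqMixin place.
HB.instance Definition _ := gen_choiceMixin place.

Definition regular_at (P : place) (g : L) : Prop := g = 0 \/ 0 <= ord P g.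

Definition vanishes_at (P : place) (g : L) : Prop := g = 0 \/ 0 < ord P g.

Definition value_at (P : place) (g : L) (c : k) : Prop :=
  vanishes_at P (g - cst c).

End Points.

Section Pullback.
Variables (k : fieldType) (L1 L2 : comUnitRingType).
Variables (cst1 : k -> L1) (cst2 : k -> L2) (phi : {rmorphism L2 -> L1}).
Hypotheses (phi_bij : bijective phi) (phi_cst : forall c, phi (cst2 c) = cst1 c).
Variable P : place cst1.

Let ordphi (h : L2) : int := ord P (phi h).

Fact phi_neq0 (h : L2) : h != 0 -> phi h != 0.
Proof. by move=> h0; rewrite -(rmorph0 phi) (inj_eq (bij_inj phi_bij)). Qed.

Fact ordphi0 : ordphi 0 = 0.
Proof. by rewrite /ordphi rmorph0 ord0. Qed.

Fact ordphiM g h : g != 0 -> h != 0 -> ordphi (g * h) = ordphi g + ordphi h.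
Proof. by move=> g0 h0; rewrite /ordphi rmorphM ordM ?phi_neq0. Qed.

Fact ordphiD g h : g != 0 -> h != 0 -> g + h != 0 ->
  Num.min (ordphi g) (ordphi h) <= ordphi (g + h).
Proof.
move=> g0 h0 gh0.
by rewrite /ordphi rmorphD ordD ?phi_neq0 // -rmorphD phi_neq0.
Qed.

Fact ordphi_cst c : c != 0 -> ordphi (cst2 c) = 0.
Proof. by move=> c0; rewrite /ordphi phi_cst ord_cst. Qed.

Fact ordphi_normalized : exists h, ordphi h = 1.
Proof.
have [h Ph1] := ord_normalized P; have [psi _ psiK] := phi_bij.
by exists (psi h); rewrite /ordphi psiK.
Qed.

Definition pullback_place : place cst2 :=
  Place ordphi0 ordphiM ordphiD ordphi_cst ordphi_normalized.

End Pullback.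

(* The group of points of the Jacobian over an algebraically closed field is  *)
(* the group of divisors of degree 0 modulo principal divisors.               *)

Section Jacobian.
Variables (K : closedFieldType) (L : comUnitRingType) (cst : K -> L).

Definition degree0 := [pred D : {freeg (place cst) / int} | deg D == 0].

Fact degree0_zmod_closed : zmod_closed degree0.
Proof.
split=> [|D E]; rewrite !inE ?deg0 // => /eqP D0 /eqP E0.
by rewrite degB D0 E0.
Qed.

HB.instance Definition _ :=
  GRing.isZmodClosed.Build {freeg (place cst) / int} degree0 degree0_zmod_closed.

Record div0 := Div0 {
  divisor :> {freeg (place cst) / int};
  _ : divisor \in degree0
}.

HB.instance Definition _ := [isSub for divisor].
HB.instance Definition _ := [Choice of div0 by <:].
HB.instance Definition _ := [SubChoice_isSubZmodule of div0 by <:].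

Definition principal (D : div0) : bool :=
  `[< exists2 h : L, h \is a GRing.unit & forall P, coeff P D = ord P h >].

Fact principal_zmod_closed : zmod_closed principal.
Proof.
have unit_neq0 (h : L) : h \is a GRing.unit -> h != 0.
  by move=> uh; apply: contraTneq uh => ->; rewrite unitr0.
split=> [|D E /asboolP[g ug Dg] /asboolP[h uh Eh]]; apply/asboolP.
  exists 1 => [|P]; first exact: unitr1.
  rewrite coeff0; apply: (addrI (ord P 1)).
  by rewrite addr0 -ordM ?oner_neq0 // mulr1.
have ugh : g / h \is a GRing.unit by rewrite unitrM ug unitrV.
exists (g / h) => // P; rewrite coeffB Dg Eh; apply/eqP.
by rewrite subr_eq -ordM ?divrK ?unit_neq0.
Qed.

HB.instance Definition _ :=
  GRing.isZmodClosed.Build div0 principal principal_zmod_closed.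

Definition principal_divisors : zmodClosed div0 :=
  GRing.ZmodClosed.clone div0 principal _.

Definition jacobian : zmodType := Quotient.quot principal_divisors.

Fact place_diff_degree0 (O P : place cst) : << P >> - << O >> \in degree0.
Proof. by rewrite inE degB !degU subrr. Qed.

(* The embedding of the curve in its Jacobian that sends O to 0. *)
Definition abel_jacobi (O P : place cst) : jacobian :=
  \pi_(Quotient.quot principal_divisors)%qT (Div0 (place_diff_degree0 O P)).

End Jacobian.

Section SuperellipticCurve.
Variables (k : fieldType) (d : nat) (f : {poly k}).

Definition curve_poly : {poly {fraction {poly k}}} := 'X^d - (tofrac f)%:P.

(* k(x)[y] / (y ^+ d - f(x)); it is a field when d is positive and prime to   *)
(* the degree of f, see funfield_unitE.                                       *)
Definition funfield := {poly %/ curve_poly}.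

HB.instance Definition _ := GRing.ComUnitRing.on funfield.

Definition fun_of_poly (p : {poly {poly k}}) : funfield :=
  in_qpoly curve_poly (map_poly tofrac p).

Definition fun_cst (c : k) : funfield := fun_of_poly c%:P%:P.
Definition fun_x : funfield := fun_of_poly 'X%:P.
Definition fun_y : funfield := fun_of_poly 'X.

Definition point := place fun_cst.

(* P is the point (a, b) of the affine curve. *)
Definition is_affine_point (P : point) (a b : k) : Prop :=
  value_at P fun_x a /\ value_at P fun_y b.

(* P is not on the affine curve. *)
Definition at_infinity (P : point) : Prop :=
  ~ (regular_at P fun_x /\ regular_at P fun_y).

End SuperellipticCurve.

Lemma XnsubC_monic_irreducible (F : fieldType) (d : nat) (a : F) :
    (0 < d)%N -> (forall (u : F) r, (0 < r)%N -> u ^+ d = a ^+ r -> (d %| r)%N) ->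
  monic_irreducible_poly ('X^d - a%:P).
Proof.
move=> d_gt0 a_root; set h := 'X^d - a%:P.
have szh : size h = d.+1 by rewrite size_XnsubC.
have mh : h \is monic by apply: monicXnsubC.
split=> //; split=> [|q q_neq1 q_dvd]; first by rewrite szh ltnS.
have q0 : q != 0 by apply: contraTneq q_dvd => ->; rewrite dvd0p monic_neq0.
have szq : (0 < (size q).-1)%N.
  by move: q_neq1 q0; rewrite -size_poly_eq0; case: (size q) => [|[]].
pose p := (lead_coef q)^-1 *: q.
have lq0 : (lead_coef q)^-1 != 0 by rewrite invr_eq0 lead_coef_eq0.
have mp : p \is monic by rewrite monicE lead_coefZ mulVf // lead_coef_eq0.
have szp : size p = size q by rewrite size_scale.
have p_dvd : p %| h by rewrite dvdpZl.
have [M chM] : exists M : 'M_((size q).-1), char_poly M = p.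
  by rewrite -szp; exists (companionmx p); rewrite companionmxK.
have d_dvd : (d %| (size q).-1)%N.
  case: (size q).-1 szq M chM => // r _ M chM.
  apply: (a_root (\det M)) => //.
  have : horner_mx M h = 0.
    by have /dvdpP[s ->] := p_dvd; rewrite rmorphM /= -chM Cayley_Hamilton mulr0.
  rewrite rmorphB /= horner_mx_C rmorphXn /= horner_mx_X => /eqP.
  rewrite subr_eq0 => /eqP hM; rewrite -(det_scalar r.+1 a) -hM.
  elim: {hM d_gt0 a_root}d {h szh mh q_dvd p_dvd} => [|m IHm]; first by rewrite !expr0 det1.
  by rewrite !exprS det_mulmx IHm.
rewrite -(dvdp_size_eqp q_dvd) szh eqn_leq; apply/andP; split.
  by rewrite -szh dvdp_leq ?monic_neq0.
by have := dvdn_leq szq d_dvd; rewrite -ltnS prednK // lt0n size_poly_eq0.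
Qed.

Lemma tofrac_root (k : fieldType) (f : {poly k}) d r (u : {fraction {poly k}}) :
  coprime (size f).-1 d -> f != 0 -> u ^+ d = tofrac f ^+ r -> (d %| r)%N.
Proof.
move=> cop f0.
have [a [b b0 ->]] : exists a, exists2 b, b != 0 & u = tofrac a / tofrac b.
  elim/quotW: u => x; exists \n_x, \d_x; first exact: denom_ratioP.
  apply: (canRL (mulfK _)); first by rewrite tofrac_eq0 denom_ratioP.
  rewrite !piE; apply/eqP; rewrite piE /= FracField.equivfE /=.
  by rewrite !numden_Ratio ?mulr1 ?oner_eq0 ?denom_ratioP // mulrC.
have bF0 : tofrac b ^+ d != 0 by rewrite expf_eq0 tofrac_eq0 (negPf b0) andbF.
rewrite expr_div_n => /(canRL (divfK bF0)).
rewrite -!tofracXn -tofracM => /eqP; rewrite tofrac_eq => /eqP /(congr1 (fun p : {poly k} => (size p).-1)).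
have fr0 : f ^+ r != 0 by rewrite expf_neq0.
have bd0 : b ^+ d != 0 by rewrite expf_neq0.
rewrite size_exp size_mul // -subn2.
have := size_exp f r; have := size_exp b d.
move: fr0 bd0; rewrite -!size_poly_gt0.
case: (size (f ^+ r)) => // s _; case: (size (b ^+ d)) => // t _ /= -> ->.
rewrite addnS addSn subn2 /= => E.
have : (d %| (size f).-1 * r)%N.
  by rewrite -(dvdn_addl _ (dvdn_mull (size b).-1 (dvdnn d))) -E dvdn_mull.
by rewrite Gauss_dvdr // coprime_sym.
Qed.

Lemma curve_poly_monic_irreducible (k : fieldType) (d : nat) (f : {poly k}) :
  (0 < d)%N -> coprime (size f).-1 d -> monic_irreducible_poly (curve_poly d f).
Proof.
move=> d_gt0 cop; apply: XnsubC_monic_irreducible => // u r _.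
have [f0|f0] := eqVneq f 0; last exact: tofrac_root.
by move: cop; rewrite f0 size_poly0 /coprime gcd0n => /eqP->; rewrite dvd1n.
Qed.

Lemma funfield_unitE (k : fieldType) (d : nat) (f : {poly k}) (g : funfield d f) :
  (0 < d)%N -> coprime (size f).-1 d -> (g \is a GRing.unit) = (g != 0).
Proof.
move=> d_gt0 cop; have hI := curve_poly_monic_irreducible d_gt0 cop.
apply/idP/idP => [ug|]; last exact: (coprimep_unit hI).
by apply: contraTneq ug => ->; rewrite unitr0.
Qed.

(* Curves over a subfield k0 of k, given by its embedding iota: the base      *)
(* change to k of the curve y ^+ d = f(x) over k0 is the curve over k defined *)
(* by map_poly iota f.                                                        *)

Section Subfield.
Variables (k0 k : fieldType) (iota : {rmorphism k0 -> k}) (d : nat).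

Definition subfun_of_poly (f : {poly k0}) (p : {poly {poly k0}}) :
    funfield d (map_poly iota f) :=
  fun_of_poly d (map_poly iota f) (map_poly (map_poly iota) p).

(* h belongs to the function field over k0, seen inside the one over k. *)
Definition fun_over (f : {poly k0}) (h : funfield d (map_poly iota f)) : Prop :=
  exists p q, subfun_of_poly f q != 0 /\
    h * subfun_of_poly f q = subfun_of_poly f p.

(* P is a k0-point: its image on the curve over k0 has residue field k0. *)
Definition rational_point (f : {poly k0}) (P : point d (map_poly iota f)) : Prop :=
  forall h, fun_over h -> regular_at P h -> exists c : k0, value_at P h (iota c).

(* A k0-isomorphism from the curve of f to the curve of g, given by its       *)
(* comorphism, which carries the function field over k0 of the second onto    *)
(* that of the first.                                                         *)
Record curve_iso (f g : {poly k0}) := CurveIso {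
  comorph :
    {rmorphism funfield d (map_poly iota g) -> funfield d (map_poly iota f)};
  comorph_bij : bijective comorph;
  comorph_cst : forall c : k, comorph (fun_cst d _ c) = fun_cst d _ c;
  comorph_over : forall h, fun_over (comorph h) <-> fun_over h
}.

Definition on_points (f g : {poly k0}) (phi : curve_iso f g) :
    point d (map_poly iota f) -> point d (map_poly iota g) :=
  pullback_place (comorph_bij phi) (comorph_cst phi).

(* The curve of f is k0-isomorphic to that of g, with O going to the point at *)
(* infinity and P going to (0, 1).                                            *)
Definition isomorphic_to_01 (f g : {poly k0}) (O P : point d (map_poly iota f)) :
    Prop :=
  exists phi : curve_iso f g,
    at_infinity (on_points phi O) /\ is_affine_point (on_points phi P) 0 1.

End Subfield.

Definition ell0 (n d : nat) : nat := ((n + d) %/ d)%N.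
Definition m0 (n d : nat) : nat := (d * ell0 n d)%N.

(* The subtraction of natural numbers below is exact under the standing       *)
(* assumption m0 n d <= n + ell0 n d.                                         *)
Definition torsion_form (k0 : fieldType) (n d : nat) (ft : {poly k0}) : Prop :=
  exists (B : k0) (w : {poly k0}),
    [/\ B != 0, size w = (ell0 n d).+1, lead_coef w = B, w.[0] = 1 &
        ft = - (B ^+ d *: 'X^(m0 n d)) + w ^+ d] /\
    exists q : {poly k0},
      [/\ q != 0, size q = (n + ell0 n d - m0 n d).+1, q.[0] = 1 &
          w = B *: 'X^(ell0 n d) + q].

(* Main.v *)
(* Write O for the point at infinity of the curve y ^+ d = F(x) over K, where F  *)
(* is the image of f.  At a point (a, b) the local ring is a discrete valuation   *)
(* ring, with uniformizer x - a if b != 0 and y if b = 0; since all these points  *)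
(* are places, a function that is regular outside O is a polynomial in x and y.   *)
(* At O the functions x and y have orders - d and - n, so the terms of            *)
(* \sum_(i < d) a_i(x) y ^+ i have distinct orders there and cannot cancel.       *)
(* If P = (a, b) has order m0, a function with divisor m0 (P - O) is then, up to  *)
(* a constant, v(x) - y with v of degree ell0, and its norm v ^+ d - F is a       *)
(* constant multiple of (x - a) ^+ m0.  As a root of f modulo (x - a) ^+ m0, v is *)
(* determined by its value b at a, so it has coefficients in K0; moving (a, b) to *)
(* (0, 1) puts f in the required form.                                            *)
(* Conversely w(x) - y has divisor m0 (Q - O).  If i (Q - O) is principal with    *)
(* 0 < i < n, the function is a polynomial in x of degree i / d < i which has a   *)
(* zero of order i at Q, a contradiction; the case n <= i < m0 reduces to this    *)
(* one, since m0 - i < n.                                                         *)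
From HB Require Import structures.
Require Import Defs.
From mathcomp Require Import all_boot all_order all_algebra all_field.
From mathcomp Require Import fraction qpoly qfpoly ring_quotient boolp.
From mathcomp.multinomials Require Import freeg.
From mathcomp Require Import ring zify.
Set Implicit Arguments.
Unset Strict Implicit.
Unset Printing Implicit Defensive.
Import Order.TTheory GRing.Theory Num.Theory.
Local Open Scope ring_scope.

(** * Orders at a place *)

(** The curve is studied through the places of its function field, handled as a field L with a map
    [j] from polynomials in x and y ([affine_model]). Smoothness makes the local ring at every
    solution (a, b) of y^d = F(x) a discrete valuation ring, so exactly one place is centered there
    ([affine_place_ex], [affine_place_uniq]). At most one place lies elsewhere ([infinity_uniq]),
    and there the pole order of a sum of terms a_i(x) y^i with i < d is the maximum of d deg a_i + n
    i ([infinity_ord]). A function without poles at affine places is such a sum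
    ([regular_polynomial]). By [abel_jacobi_mulrn_eq0], torsion thus becomes a question about
    polynomials.

    The number m0 is the multiple of d strictly between n and n + d. A function with divisor m0 (P -
    O) must then be a_0(x) + c y with c constant and deg a_0 = ell0, that is v(x) - y after scaling.
    Its norm v^d - F has degree m0 and vanishes at a to order m0, so F is v^d minus a multiple of (x
    - a)^m0 ([principal_m0_form]). Here b is nonzero, because d (P - O) is principal when b = 0
    ([ramified_principal]). A d-th root of a power series is determined by its constant term, so v
    is defined over K0 ([torsion_form_descent]), and a translation of x with a scaling of y carries
    P to (0, 1) ([curve_iso_translation]). The degree of q comes from factoring a difference of d-th
    powers ([torsion_form_intro]).

    Conversely, w^d - F = B^d x^m0 shows that w(x) - y has divisor m0 (Q - O)
    ([torsion_form_principal]). Smaller multiples are not principal ([small_mult_not_principal],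
    [torsion_form_order]), and isomorphisms preserve principal multiples ([principal_mult_push]), so
    the order passes back to P. *)

Section PlaceTheory.
Variables (k : fieldType) (L : comUnitRingType) (cst : k -> L).
Hypothesis L_unit : forall g : L, g != 0 -> g \is a GRing.unit.

Lemma unit_mulf_neq0 (g h : L) : g != 0 -> h != 0 -> g * h != 0.
Proof.
move=> g0 h0; have : g * h \is a GRing.unit by rewrite unitrM !L_unit.
by apply: contraTneq => ->; rewrite unitr0.
Qed.

Lemma unit_expf_neq0 (g : L) i : g != 0 -> g ^+ i != 0.
Proof.
by move=> g0; elim: i => [|i IHi]; rewrite ?oner_neq0 // exprS unit_mulf_neq0.
Qed.

Lemma unit_mulIf (g h1 h2 : L) : g != 0 -> h1 * g = h2 * g -> h1 = h2.
Proof. by move=> /L_unit gu /(mulIr gu). Qed.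

Section OnePlace.
Variable P : place cst.

(** The disjunct [g = 0] stands for order +oo: [ord] has the conventional value 0 at 0, so the bare
    inequality would not be stable under sums. *)
Definition ord_ge (e : int) (g : L) : Prop := g = 0 \/ e <= ord P g.

Lemma ord_one : ord P 1 = 0.
Proof.
by apply: (addrI (ord P 1)); rewrite -ordM ?oner_neq0 // mulr1 addr0.
Qed.

Lemma ordX g i : g != 0 -> ord P (g ^+ i) = ord P g *+ i.
Proof.
move=> g0; elim: i => [|i IHi]; first by rewrite ord_one.
by rewrite exprS ordM ?unit_expf_neq0 // IHi mulrS.
Qed.

Lemma ordN g : ord P (- g) = ord P g.
Proof.
have [->|g0] := eqVneq g 0; first by rewrite oppr0.
have N1 : (-1 : L) != 0 by rewrite oppr_eq0 oner_neq0.
have : ord P (-1) *+ 2 = 0 by rewrite -ordX // sqrrN expr1n ord_one.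
move=> /eqP; rewrite mulrn_eq0 /= => /eqP oN1.
by rewrite -mulN1r ordM // oN1 add0r.
Qed.

Lemma ord_geP e g : g != 0 -> ord_ge e g -> e <= ord P g.
Proof. by move=> /eqP g0 []. Qed.

Lemma ord_geN e g : ord_ge e g -> ord_ge e (- g).
Proof. by case=> [->|eg]; [left; rewrite oppr0 | right; rewrite ordN]. Qed.

Lemma ord_geD e g h : ord_ge e g -> ord_ge e h -> ord_ge e (g + h).
Proof.
have [->|g0] := eqVneq g 0; first by rewrite add0r.
have [->|h0] := eqVneq h 0; first by rewrite addr0.
move=> /(ord_geP g0) eg /(ord_geP h0) eh.
have [->|gh0] := eqVneq (g + h) 0; first by left.
by right; apply: le_trans (ordD P g0 h0 gh0); rewrite le_min eg.
Qed.

Lemma ord_geM e1 e2 g h : ord_ge e1 g -> ord_ge e2 h -> ord_ge (e1 + e2) (g * h).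
Proof.
have [->|g0] := eqVneq g 0; first by rewrite mul0r; left.
have [->|h0] := eqVneq h 0; first by rewrite mulr0; left.
move=> /(ord_geP g0) eg /(ord_geP h0) eh.
by right; rewrite ordM // lerD.
Qed.

Lemma ord_geW e1 e2 g : e1 <= e2 -> ord_ge e2 g -> ord_ge e1 g.
Proof. by move=> e12 [->|eg]; [left|right; apply: le_trans eg]. Qed.

(** The reverse bound is the ultrametric inequality for g = (g + h) - h, where h has too large an
    order to realize the minimum. *)
Lemma ord_addl g h : g != 0 -> ord_ge (ord P g + 1) h ->
  g + h != 0 /\ ord P (g + h) = ord P g.
Proof.
move=> g0; have [->|h0] := eqVneq h 0; first by rewrite addr0.
move=> /(ord_geP h0); rewrite lezD1 => lt_gh.
have gh0 : g + h != 0.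
  by apply: contraTneq lt_gh => /eqP; rewrite addr_eq0 => /eqP->; rewrite ordN ltxx.
split=> //; apply/eqP; rewrite eq_le andbC.
have := ordD P g0 h0 gh0; rewrite (min_l (ltW lt_gh)) => -> /=.
have Nh0 : - h != 0 by rewrite oppr_eq0.
have := ordD P gh0 Nh0; rewrite addrK ordN => /(_ g0).
by rewrite ge_min => /orP[//|]; rewrite leNgt lt_gh.
Qed.

(** When the terms are added one by one, each new nonzero term differs in order from the partial
    sum, so [ord_addl] applies. The minimizing index is kept because it gives the pole order at
    infinity. *)
Lemma ord_sum_distinct m (T : nat -> L) :
    (forall i j, (i < m)%N -> (j < m)%N -> T i != 0 -> T j != 0 ->
       ord P (T i) = ord P (T j) -> i = j) ->
  (forall i, (i < m)%N -> T i = 0) \/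
  exists i, [/\ (i < m)%N, T i != 0, \sum_(j < m) T j != 0,
    ord P (\sum_(j < m) T j) = ord P (T i) &
    forall j, (j < m)%N -> T j != 0 -> ord P (T i) <= ord P (T j)].
Proof.
elim: m => [|m IHm] T_inj; first by left.
have [|T0|[i [im Ti0 S0 SE Smin]]] := IHm.
- by move=> i j im jm; apply: T_inj; rewrite leqW.
- have S0 : \sum_(j < m) T j = 0 by rewrite big1 // => j _; apply: T0.
  have [Tm0|Tm0] := eqVneq (T m) 0.
    by left=> i; rewrite ltnS leq_eqVlt => /predU1P[->|/T0].
  right; exists m; rewrite big_ord_recr /= S0 add0r; split=> // j.
  by rewrite ltnS leq_eqVlt => /predU1P[->|/T0->]; rewrite ?eqxx.
right; rewrite big_ord_recr /=.
have [Tm0|Tm0] := eqVneq (T m) 0.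
  exists i; rewrite Tm0 addr0 leqW //; split=> // j.
  rewrite ltnS leq_eqVlt => /predU1P[->|/Smin//]; by rewrite Tm0 eqxx.
have [lt_im|lt_mi|eq_im] := ltgtP (ord P (T i)) (ord P (T m)).
- exists i; have [|-> ->] := @ord_addl (\sum_(j < m) T j) (T m) S0.
    by right; rewrite SE lezD1.
  split=> //; first exact: leqW.
  by move=> j; rewrite ltnS leq_eqVlt => /predU1P[-> _|/Smin//]; apply: ltW.
- exists m; rewrite addrC; have [|-> ->] := @ord_addl (T m) (\sum_(j < m) T j) Tm0.
    by right; rewrite SE lezD1.
  split=> // j; rewrite ltnS leq_eqVlt => /predU1P[->//|jm Tj0].
  exact: le_trans (ltW lt_mi) (Smin _ jm Tj0).
- by have := T_inj i m (leqW im) (ltnSn m) Ti0 Tm0 eq_im => ii; rewrite ii ltnn in im.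
Qed.

End OnePlace.

Lemma place_eq (P Q : place cst) : (forall g : L, g != 0 -> ord P g = ord Q g) -> P = Q.
Proof.
move=> PQ; have {PQ} : ord P = ord Q.
  by apply: funext => g; have [->|/PQ//] := eqVneq g 0; rewrite !Defs.ord0.
case: P Q => [o p1 p2 p3 p4 p5] [o' q1 q2 q3 q4 q5] /= oo'.
by subst o'; congr Place; apply: Prop_irrelevance.
Qed.

End PlaceTheory.

(** * The place of a discrete valuation ring *)

Lemma intz_shift (x y e : int) (n m : nat) :
  e + n%:Z = m%:Z -> x + y *+ n = y *+ m -> x = e * y.
Proof.
move=> nm; rewrite -(mulr_natl y n) -(mulr_natl y m) (natz n) (natz m) -nm mulrDl.
by move=> H; apply: addIr H.
Qed.

(* The image of A in L is a coordinate ring and ev a point; its local ring is     *)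
(* a discrete valuation ring with uniformizer pi: by ev_pi_dvd pi generates its   *)
(* maximal ideal, and by dvd_pi_exp every nonzero function divides a power of pi, *)
(* which bounds its order.                                                        *)
Section LocalRing.
Variables (k : fieldType) (A : comNzRingType) (L : comUnitRingType) (cst : k -> L).
Variables (j : {rmorphism A -> L}) (ev : {rmorphism A -> k}) (pi : A).
Hypothesis L_unit : forall g : L, g != 0 -> g \is a GRing.unit.
Hypothesis cst_lift : forall c, exists2 p, cst c = j p & ev p = c.
Hypothesis j_ev : forall p, j p = 0 -> ev p = 0.
Hypothesis j_frac : forall h, exists p q, j q != 0 /\ h * j q = j p.
Hypothesis j_pi : j pi != 0.
Hypothesis ev_pi : ev pi = 0.
Hypothesis ev_pi_dvd : forall p, ev p = 0 ->
  exists u q, ev u != 0 /\ j u * j p = j pi * j q.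
Hypothesis dvd_pi_exp : forall p, j p != 0 ->
  exists E s q, ev s != 0 /\ j s * j pi ^+ E = j p * j q.

Let pi_unit : j pi \is a GRing.unit. Proof. exact: L_unit. Qed.

Lemma ev_neq0_j p : ev p != 0 -> j p != 0.
Proof. by apply: contraNneq => /j_ev->. Qed.

(** Here h is pi^e times g / s, a unit of the local ring, with the denominator cleared. *)
Definition local_ord (h : L) (e : int) : Prop :=
  exists s g, [/\ ev s != 0, ev g != 0 & h * j s = j pi ^ e * j g].

Lemma local_ord_neq0 h e : local_ord h e -> h != 0.
Proof.
move=> [s [g [es eg E]]]; apply: contraTneq isT => h0.
have : j pi ^ e * j g \is a GRing.unit by rewrite unitrM unitrXz // L_unit ?ev_neq0_j.
by rewrite -E h0 mul0r unitr0.
Qed.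

Lemma local_ordM h1 h2 e1 e2 :
  local_ord h1 e1 -> local_ord h2 e2 -> local_ord (h1 * h2) (e1 + e2).
Proof.
move=> [s1 [g1 [es1 eg1 E1]]] [s2 [g2 [es2 eg2 E2]]].
exists (s1 * s2), (g1 * g2); rewrite !rmorphM !mulf_neq0 //; split=> //.
by rewrite mulrACA E1 E2 mulrACA exprzDr.
Qed.

Lemma local_ord_divr h1 h2 e e2 :
  local_ord (h1 * h2) e -> local_ord h2 e2 -> local_ord h1 (e - e2).
Proof.
move=> [s1 [g1 [es1 eg1 E1]]] o2; have h20 := local_ord_neq0 o2.
move: o2 => [s2 [g2 [es2 eg2 E2]]].
exists (s1 * g2), (g1 * s2); rewrite !rmorphM !mulf_neq0 //; split=> //.
have pe2 : j pi ^ e2 \is a GRing.unit by rewrite unitrXz.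
rewrite -{1}(subrK e2 e) exprzDr // in E1; apply: (mulIr pe2).
transitivity (h1 * j s1 * (h2 * j s2)); first by rewrite E2; ring.
transitivity (h1 * h2 * j s1 * j s2); first by ring.
by rewrite E1; ring.
Qed.

(** If e2 exceeded e1, then g1 s2 would be a multiple of pi on the curve and vanish at the point,
    although neither factor does. *)
Lemma local_ord_uniq h e1 e2 : local_ord h e1 -> local_ord h e2 -> e1 = e2.
Proof.
wlog : e1 e2 / e1 <= e2 => [th o1 o2|e12 [s1 [g1 [es1 eg1 E1]]] [s2 [g2 [es2 eg2 E2]]]].
  by have [le12|/ltW le21] := leP e1 e2; [apply: th | apply/esym/th].
have [n en] : exists n : nat, e2 = e1 + n%:Z by exists `|e2 - e1|%N; lia.
case: n en => [|n] en; first by rewrite en addr0.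
have pe1 : j pi ^ e1 \is a GRing.unit by rewrite unitrXz.
have E : j (g1 * s2) = j (pi ^+ n.+1 * g2 * s1).
  apply: (mulIr pe1); rewrite !rmorphM mulrAC [j g1 * _]mulrC -E1 mulrAC E2 en.
  by rewrite exprzDr // -exprnP -rmorphXn; ring.
have : ev (g1 * s2 - pi ^+ n.+1 * g2 * s1) = 0 by apply: j_ev; rewrite rmorphB E subrr.
rewrite exprS rmorphB !rmorphM /= ev_pi !mul0r subr0 => /eqP.
by rewrite mulf_eq0 (negPf eg1) (negPf es2).
Qed.

(** Divide by pi as long as the numerator vanishes at the point. If this went on for E + 1 steps,
    pi^(E+1) would divide p in the local ring while p divides pi^E, and a function nonzero at the
    point would be a multiple of pi. *)
Lemma local_ord_val p : j p != 0 -> exists e : nat, local_ord (j p) e.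
Proof.
move=> jp; have [E [s0 [q [es0 E0]]]] := dvd_pi_exp jp.
suff: (exists e : nat, local_ord (j p) e) \/
    exists s g, ev s != 0 /\ j p * j s = j pi ^+ E.+1 * j g.
  case=> // -[s [g [es Es]]].
  have : ev (s0 * s - pi * g * q) = 0.
    apply: j_ev; rewrite rmorphB !rmorphM; apply/eqP; rewrite subr_eq0; apply/eqP.
    have pE : j pi ^+ E \is a GRing.unit by rewrite unitrX.
    apply: (mulIr pE); rewrite mulrAC E0.
    transitivity (j p * j s * j q); first by ring.
    by rewrite Es exprS; ring.
  rewrite rmorphB !rmorphM /= ev_pi !mul0r subr0 => /eqP.
  by rewrite mulf_eq0 (negPf es0) (negPf es).
elim: E.+1 => [|N [|[s [g [es Es]]]]]; [|by left|].
  by right; exists 1, p; rewrite rmorph1 oner_neq0 rmorph1 mulrC.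
have [eg|eg] := eqVneq (ev g) 0; last by left; exists N, s, g.
have [u [q' [eu Eu]]] := ev_pi_dvd eg.
right; exists (s * u), q'; rewrite !rmorphM mulf_neq0 //; split=> //.
by rewrite mulrA Es exprSr -mulrA [j g * _]mulrC Eu mulrA.
Qed.

Lemma local_ord_ex h : h != 0 -> exists e, local_ord h e.
Proof.
move=> h0; have [p [q [jq E]]] := j_frac h.
have jp : j p != 0 by rewrite -E unit_mulf_neq0.
have [[e1 o1] [e2 o2]] := (local_ord_val jp, local_ord_val jq).
by exists (e1%:Z - e2%:Z); apply: local_ord_divr o2; rewrite E.
Qed.

Lemma local_ordD h1 h2 e1 e2 e : local_ord h1 e1 -> local_ord h2 e2 ->
  local_ord (h1 + h2) e -> Num.min e1 e2 <= e.
Proof.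
wlog e12 : h1 h2 e1 e2 / e1 <= e2 => [th|].
  move=> o1 o2 o; have [le12|/ltW le21] := leP e1 e2.
    by have := th h1 h2 e1 e2 le12 o1 o2 o; rewrite min_l.
  by rewrite addrC in o; have := th h2 h1 e2 e1 le21 o2 o1 o; rewrite min_l.
rewrite min_l // => -[s1 [g1 [es1 eg1 E1]]] [s2 [g2 [es2 eg2 E2]]] o.
have [n en] : exists n : nat, e2 = e1 + n%:Z by exists `|e2 - e1|%N; lia.
pose g := g1 * s2 + pi ^+ n * g2 * s1.
have Eg : (h1 + h2) * j (s1 * s2) = j pi ^ e1 * j g.
  rewrite rmorphM mulrDl mulrA E1 [j s1 * _]mulrC mulrA E2 en.
  by rewrite exprzDr // -exprnP -rmorphXn rmorphD !rmorphM; ring.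
have es12 : ev (s1 * s2) != 0 by rewrite rmorphM mulf_neq0.
have jg : j g != 0.
  apply: contra_neq (local_ord_neq0 o) => jg0.
  apply: (unit_mulIf L_unit (ev_neq0_j es12)).
  by rewrite Eg jg0 mulr0 mul0r.
have [eg [s [g' [es eg' Eg']]]] := local_ord_val jg.
have o' : local_ord (h1 + h2) (e1 + eg%:Z).
  exists (s1 * s2 * s), g'; rewrite !rmorphM !mulf_neq0 //; split=> //.
  by rewrite -rmorphM mulrA Eg -mulrA Eg' mulrA exprzDr.
by rewrite (local_ord_uniq o o') lerDl.
Qed.

(** The default 0 is reached only at h = 0, as [ord0] demands. *)
Definition local_ord_fun (h : L) : int :=
  if pselect (exists e, local_ord h e) is left ex then projT1 (cid ex) else 0.

Lemma local_ord_funE h e : local_ord h e -> local_ord_fun h = e.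
Proof.
rewrite /local_ord_fun => o; case: pselect => [ex|[]]; last by exists e.
by case: cid => e' o' /=; apply: local_ord_uniq o' o.
Qed.

Lemma local_ord_cst p : ev p != 0 -> local_ord (j p) 0.
Proof. by move=> ep; exists 1, p; rewrite !rmorph1 oner_neq0 mulr1 mul1r. Qed.

Lemma local_ord_pi : local_ord (j pi) 1.
Proof. by exists 1, 1; rewrite !rmorph1 oner_neq0 mulr1. Qed.

Lemma local_ord_fun_subproof :
  [/\ local_ord_fun 0 = 0,
      forall g h, g != 0 -> h != 0 ->
        local_ord_fun (g * h) = local_ord_fun g + local_ord_fun h,
      forall g h, g != 0 -> h != 0 -> g + h != 0 ->
        Num.min (local_ord_fun g) (local_ord_fun h) <= local_ord_fun (g + h),
      forall c, c != 0 -> local_ord_fun (cst c) = 0 &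
      exists g, local_ord_fun g = 1].
Proof.
split.
- rewrite /local_ord_fun; case: pselect => // -[e o].
  by have := local_ord_neq0 o; rewrite eqxx.
- move=> g h /local_ord_ex[e1 o1] /local_ord_ex[e2 o2].
  by rewrite (local_ord_funE o1) (local_ord_funE o2); apply/local_ord_funE/local_ordM.
- move=> g h /local_ord_ex[e1 o1] /local_ord_ex[e2 o2] /local_ord_ex[e o].
  rewrite (local_ord_funE o1) (local_ord_funE o2) (local_ord_funE o).
  exact: local_ordD o.
- move=> c c0; apply: local_ord_funE.
  by have [p -> ep] := cst_lift c; apply: local_ord_cst; rewrite ep.
- by exists (j pi); apply/local_ord_funE/local_ord_pi.
Qed.

Lemma local_place_ex : exists R : place cst,
  forall p, ev p = 0 -> vanishes_at R (j p).
Proof.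
have [o0 oM oD oc o1] := local_ord_fun_subproof.
exists (Place o0 oM oD oc o1) => p ep.
have [jp|/local_ord_val[e o]] := eqVneq (j p) 0; [by left | right].
rewrite /= (local_ord_funE o); case: e o => // o.
have [s [g [es eg]]] := o; rewrite mul1r => E.
have : ev (p * s - g) = 0 by apply: j_ev; rewrite rmorphB rmorphM E subrr.
by rewrite rmorphB rmorphM /= ep mul0r sub0r => /eqP; rewrite oppr_eq0 (negPf eg).
Qed.

(** Units of the local ring have order 0 at R, so the order of h is e times that of pi, and
    normalization makes the latter 1. Hence only one place is centered at the point. *)
Lemma place_local_ord (R : place cst) :
    (forall p, ev p = 0 -> vanishes_at R (j p)) ->
  forall h e, local_ord h e -> ord R h = e.
Proof.
move=> Rev.
have ord_ev p : ev p != 0 -> ord R (j p) = 0.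
  move=> ep; have [p' Ec ep'] := cst_lift (ev p).
  have c0 : cst (ev p) != 0 by rewrite Ec ev_neq0_j // ep'.
  have [||_] := @ord_addl _ _ _ L_unit R (cst (ev p)) (j (p - p')) => //.
    by rewrite ord_cst // add0r; apply: Rev; rewrite rmorphB ep' subrr.
  by rewrite ord_cst // {1}Ec -rmorphD addrC subrK.
have ordRn : forall h (n : nat), local_ord h n -> ord R h = ord R (j pi) *+ n.
  move=> h n o; have h0 := local_ord_neq0 o; have [s [g [es eg]]] := o.
  move=> /(congr1 (ord R)); rewrite -exprnP !ordM ?unit_expf_neq0 // ?ev_neq0_j //.
  by rewrite (ord_ev s) // (ord_ev g) // !addr0 (ordX L_unit).
have ordR : forall h e, local_ord h e -> ord R h = e * ord R (j pi).
  move=> h e o; have h0 := local_ord_neq0 o.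
  (* Multiplying h by a large power of pi makes the exponent nonnegative, the case already
     treated. *)
  have [n [m nm]] : exists n m : nat, (e + n%:Z)%R = m%:Z :> int.
    by exists `|e|%N, `|(e + `|e|%N%:Z)%R|%N; lia.
  have pX : local_ord (j pi ^+ n) n%:Z.
    by exists 1, 1; rewrite !rmorph1 oner_neq0 mulr1.
  have := local_ordM o pX; rewrite nm => /ordRn.
  rewrite ordM ?unit_expf_neq0 // ordX //; exact: intz_shift nm.
have pi_gt0 : 0 < ord R (j pi).
  by have [] := Rev _ ev_pi => // /eqP; rewrite (negPf j_pi).
(* Some function has order 1, so the order of pi is invertible among the integers; it is also
   positive. *)
have pi1 : ord R (j pi) = 1.
  have [g g1] := ord_normalized R.
  have g0 : g != 0 by apply: contra_eq_neq g1 => ->; rewrite Defs.ord0.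
  have [e /ordR] := local_ord_ex g0; rewrite g1 => e1.
  have : ord R (j pi) \is a GRing.unit by apply/unitrP; exists e; rewrite -e1 mulrC -e1.
  by rewrite qualifE /= => /orP[/eqP//|/eqP]; lia.
by move=> h e /ordR->; rewrite pi1 mulr1.
Qed.

Lemma local_place_uniq (R1 R2 : place cst) :
    (forall p, ev p = 0 -> vanishes_at R1 (j p)) ->
    (forall p, ev p = 0 -> vanishes_at R2 (j p)) ->
  R1 = R2.
Proof.
move=> ev1 ev2; apply: place_eq => g /local_ord_ex[e o].
by rewrite (place_local_ord ev1 o) (place_local_ord ev2 o).
Qed.

Lemma place_ord_pi (R : place cst) :
  (forall p, ev p = 0 -> vanishes_at R (j p)) -> ord R (j pi) = 1.
Proof. by move=> Rev; apply: place_local_ord Rev _ _ local_ord_pi. Qed.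

End LocalRing.

(** * The coordinate ring of the curve *)

Local Notation "x %:F" := (@FracField.tofrac _ x).

Lemma tofrac_frac (R : idomainType) (u : {fraction R}) :
  exists a b : R, b != 0 /\ u * b%:F = a%:F.
Proof.
elim/quotW: u => x; exists \n_x, \d_x; split; first exact: denom_ratioP.
rewrite !piE; apply/eqP; rewrite piE /= FracField.equivfE /=.
by rewrite !numden_Ratio ?mulr1 ?oner_eq0 ?denom_ratioP // mulrC.
Qed.

Lemma common_denominator (R : idomainType) (g : {poly {fraction R}}) :
  exists (D : R) (p : {poly R}), D != 0 /\ D%:F *: g = map_poly (@FracField.tofrac R) p.
Proof.
elim/poly_ind: g => [|g c [D [p [D0 E]]]].
  by exists 1, 0; rewrite oner_neq0 scaler0 rmorph0.
have [a [b [b0 Ec]]] := tofrac_frac c.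
exists (D * b), (b%:P * p * 'X + (D * a)%:P); rewrite mulf_neq0 //; split=> //.
rewrite rmorphD !rmorphM /= map_polyX !map_polyC /= -E scalerDr.
congr (_ + _); first by rewrite mul_polyC scalerA -scalerAl [b%:F * _]mulrC.
by rewrite -mul_polyC -!polyCM -Ec -mulrA [b%:F * c]mulrC.
Qed.

Section FunOfPoly.
Variables (k : fieldType) (d : nat) (F : {poly k}).

Fact fun_of_poly_is_zmod_morphism : zmod_morphism (fun_of_poly d F).
Proof. by move=> p q; rewrite /fun_of_poly !rmorphB. Qed.

Fact fun_of_poly_is_monoid_morphism : monoid_morphism (fun_of_poly d F).
Proof. by split=> [|p q]; rewrite /fun_of_poly ?rmorph1 // !rmorphM. Qed.

HB.instance Definition _ := GRing.isZmodMorphism.Build {poly {poly k}}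
  (funfield d F) (fun_of_poly d F) fun_of_poly_is_zmod_morphism.
HB.instance Definition _ := GRing.isMonoidMorphism.Build {poly {poly k}}
  (funfield d F) (fun_of_poly d F) fun_of_poly_is_monoid_morphism.

End FunOfPoly.

(** The outer variable is y and the inner one x. *)
Definition pt_eval (k : fieldType) (a b : k) (p : {poly {poly k}}) : k :=
  p.[b%:P].[a].

Section PtEval.
Variables (k : fieldType) (a b : k).

Fact pt_eval_is_zmod_morphism : zmod_morphism (pt_eval a b).
Proof. by move=> p q; rewrite /pt_eval !hornerE. Qed.

Fact pt_eval_is_monoid_morphism : monoid_morphism (pt_eval a b).
Proof. by split=> [|p q]; rewrite /pt_eval ?hornerE // hornerM hornerM. Qed.

HB.instance Definition _ := GRing.isZmodMorphism.Build {poly {poly k}}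
  k (pt_eval a b) pt_eval_is_zmod_morphism.
HB.instance Definition _ := GRing.isMonoidMorphism.Build {poly {poly k}}
  k (pt_eval a b) pt_eval_is_monoid_morphism.

Lemma pt_evalC q : pt_eval a b q%:P = q.[a].
Proof. by rewrite /pt_eval hornerC. Qed.

Lemma pt_evalX : pt_eval a b 'X = b.
Proof. by rewrite /pt_eval hornerX hornerC. Qed.

(** The maximal ideal of (a, b) is generated by y - b and x - a: apply the factor theorem in y, then
    in x. *)
Lemma pt_eval_decomp p : exists q1 q2,
  p = (pt_eval a b p)%:P%:P + q1 * ('X - b%:P%:P) + q2%:P * ('X - a%:P)%:P.
Proof.
have /factor_theorem[q1 E1] : root (p - p.[b%:P]%:P) b%:P.
  by rewrite /root !hornerE subrr.
have /factor_theorem[q2 E2] : root (p.[b%:P] - p.[b%:P].[a]%:P) a.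
  by rewrite /root !hornerE subrr.
exists q1, q2; rewrite -E1 -polyCM -E2 /pt_eval polyCB.
by rewrite addrC addrA addrNK addrC addrNK.
Qed.

End PtEval.

Section Curve.
Variables (k : fieldType) (d : nat) (F : {poly k}).
Hypotheses (d_gt1 : (1 < d)%N) (cop : coprime (size F).-1 d).

Let d_gt0 : (0 < d)%N. Proof. exact: ltnW. Qed.

Local Notation L := (funfield d F).
Local Notation j := (fun_of_poly d F).
Local Notation x := (fun_x d F).
Local Notation y := (fun_y d F).
Local Notation cst := (fun_cst d F).

Lemma mk_monic_curve : mk_monic (curve_poly d F) = curve_poly d F.
Proof. exact: (mk_monicE (curve_poly_monic_irreducible d_gt0 cop)). Qed.

Lemma size_curve_poly : size (curve_poly d F) = d.+1.
Proof. by rewrite /curve_poly size_XnsubC. Qed.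

Lemma fun_of_poly_small (p : {poly {poly k}}) : (size p <= d)%N ->
  j p = map_poly (@FracField.tofrac _) p :> {poly {fraction {poly k}}}.
Proof.
move=> sp; rewrite in_qpoly_small // mk_monic_curve size_curve_poly ltnS.
exact: leq_trans (size_poly _ _) sp.
Qed.

Lemma map_tofrac_inj : injective (map_poly (@FracField.tofrac {poly k})).
Proof.
apply: map_inj_poly; last exact: tofrac0.
by move=> p q /eqP; rewrite tofrac_eq => /eqP.
Qed.

Lemma fun_of_poly_inj (p q : {poly {poly k}}) :
  (size p <= d)%N -> (size q <= d)%N -> j p = j q -> p = q.
Proof.
by move=> sp sq E; apply: map_tofrac_inj; rewrite -!fun_of_poly_small // E.
Qed.

Lemma fun_of_poly_eq0 (p : {poly {poly k}}) : (size p <= d)%N -> (j p == 0) = (p == 0).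
Proof.
move=> sp; apply/eqP/eqP => [E|->]; last by rewrite rmorph0.
by apply: fun_of_poly_inj; rewrite ?size_poly0 // rmorph0.
Qed.

Lemma fun_of_poly_curve : j ('X^d - F%:P) = 0.
Proof.
have E : map_poly (@FracField.tofrac _) ('X^d - F%:P) = curve_poly d F.
  by rewrite rmorphB /= map_polyXn map_polyC.
rewrite /fun_of_poly E; apply: val_inj.
transitivity (0 : {poly {fraction {poly k}}}); last by [].
transitivity (Pdiv.CommonRing.rmodp (curve_poly d F) (mk_monic (curve_poly d F))); first by [].
by rewrite mk_monic_curve Pdiv.RingMonic.rmodpp // monicXnsubC.
Qed.

(** A representative of degree less than d in y over k(x) only needs the denominators of its
    coefficients cleared, so D involves x alone. *)
Lemma fun_of_poly_frac (h : L) : exists (D : {poly k}) (p : {poly {poly k}}),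
  [/\ D != 0, (size p <= d)%N & h * j D%:P = j p].
Proof.
have [D [p [D0 E]]] := common_denominator (h : {poly {fraction {poly k}}}).
have DF0 : D%:F != 0 by rewrite tofrac_eq0.
have sp : (size p <= d)%N.
  rewrite -(size_map_inj_poly _ (tofrac0 _)) => [|u v /eqP]; last by rewrite tofrac_eq => /eqP.
  have Es : size (mk_monic (curve_poly d F)) = d.+1.
    by rewrite mk_monic_curve size_curve_poly.
  by rewrite -E size_scale // -ltnS -Es size_mk_monic.
exists D, p; split=> //; apply: val_inj.
transitivity (map_poly (@FracField.tofrac _) p); last exact/esym/fun_of_poly_small.
transitivity (Pdiv.CommonRing.rmodp ((h : {poly {fraction {poly k}}}) *
  (j D%:P : {poly {fraction {poly k}}})) (mk_monic (curve_poly d F))); first by [].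
rewrite fun_of_poly_small ?size_polyC ?D0 // map_polyC mulrC mul_polyC -E.
by apply: Pdiv.CommonRing.rmodp_small; rewrite size_scale // size_mk_monic.
Qed.

End Curve.

(** This is the value of the cofactor of u - v in u^n - v^n where u and v both equal b. For n = d
    and b nonzero it is nonzero, because d is invertible; this is how the hypothesis on the
    characteristic enters most arguments below. *)
Lemma sum_expr_same (R : comNzRingType) (b : R) n :
  \sum_(i < n) b ^+ (n.-1 - i) * b ^+ i = b ^+ n.-1 *+ n.
Proof.
rewrite (eq_bigr (fun=> b ^+ n.-1)) => [|i _]; first by rewrite sumr_const card_ord.
by rewrite -exprD subnK // -ltnS prednK // (leq_ltn_trans _ (ltn_ord i)).
Qed.

(* L is the field of fractions of the affine coordinate ring of y ^+ d = F(x), *)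
(* and j maps a polynomial in y over k[x] to the function that it defines.     *)
Record affine_model (k : fieldType) (d : nat) (F : {poly k}) (L : comUnitRingType)
    (j : {rmorphism {poly {poly k}} -> L}) : Prop := AffineModel {
  model_unit : forall g : L, g != 0 -> g \is a GRing.unit;
  model_inj : forall p : {poly {poly k}}, (size p <= d)%N -> j p = 0 -> p = 0;
  model_curve : j ('X^d - F%:P) = 0;
  model_frac : forall h : L, exists (D : {poly k}) (p : {poly {poly k}}),
    [/\ D != 0, (size p <= d)%N & h * j D%:P = j p]
}.

(** * Affine points *)

Section AffineModel.
Variables (k : fieldType) (d : nat) (F : {poly k}) (L : comUnitRingType).
Variables (j : {rmorphism {poly {poly k}} -> L}) (cst : k -> L).
Hypotheses (M : affine_model d F j) (cstE : forall c, cst c = j c%:P%:P).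
Hypotheses (d_gt1 : (1 < d)%N) (d_neq0 : d%:R != 0 :> k).

Local Notation x := (j 'X%:P).
Local Notation y := (j 'X).

Let d_gt0 : (0 < d)%N. Proof. exact: ltnW. Qed.
Let L_unit := model_unit M.

Lemma model_y : y ^+ d = j F%:P.
Proof.
by have /eqP := model_curve M; rewrite rmorphB subr_eq0 rmorphXn => /eqP.
Qed.

Lemma model_reduce p : exists q r : {poly {poly k}},
  [/\ (size r <= d)%N, p = q * ('X^d - F%:P) + r & j p = j r].
Proof.
have mH : 'X^d - F%:P \is monic by apply: monicXnsubC.
exists (Pdiv.CommonRing.rdivp p ('X^d - F%:P)), (Pdiv.CommonRing.rmodp p ('X^d - F%:P)).
have E := Pdiv.RingMonic.rdivp_eq mH p.
split=> //.
  by rewrite -ltnS -(size_XnsubC F d_gt0) Pdiv.CommonRing.ltn_rmodp monic_neq0.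
by rewrite {1}E rmorphD rmorphM /= model_curve // mulr0 add0r.
Qed.

Lemma model_ker p : j p = 0 -> exists q, p = q * ('X^d - F%:P).
Proof.
have [q [r [sr -> ->]]] := model_reduce p.
by move=> /(model_inj M sr) ->; exists q; rewrite addr0.
Qed.

Lemma model_C_neq0 (D : {poly k}) : D != 0 -> j D%:P != 0.
Proof.
move=> D0; apply: contra_neq D0 => /(model_inj M) E.
by apply: polyC_inj; apply: E; rewrite size_polyC (leq_trans (leq_b1 _)).
Qed.

Lemma model_neq0 (p : {poly {poly k}}) : (size p <= d)%N -> p != 0 -> j p != 0.
Proof. by move=> sp; apply: contra_neq => /(model_inj M sp). Qed.

Lemma model_y_neq0 : y != 0.
Proof. by rewrite model_neq0 ?polyX_eq0 ?size_polyX. Qed.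

(** The inverse of [j p] has a denominator in x alone; D plays the role of the norm of p. *)
Lemma model_dvd p : j p != 0 -> exists (D : {poly k}) q,
  D != 0 /\ j p * j q = j D%:P.
Proof.
move=> jp; have [D [q [D0 _ E]]] := model_frac M (j p)^-1.
by exists D, q; split=> //; rewrite -E mulrA divrr ?mul1r // L_unit.
Qed.

Lemma model_quotient h : exists p q, j q != 0 /\ h * j q = j p.
Proof.
have [D [p [D0 _ E]]] := model_frac M h.
by exists p, D%:P; rewrite model_C_neq0.
Qed.

Lemma model_ev_ker a b : b ^+ d = F.[a] -> forall p, j p = 0 -> pt_eval a b p = 0.
Proof.
move=> ab p /model_ker[q ->]; rewrite rmorphM rmorphB rmorphXn /=.
by rewrite pt_evalX pt_evalC ab subrr mulr0.
Qed.

Lemma model_cst_lift a b c : exists2 p, cst c = j p & pt_eval a b p = c.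
Proof. by exists c%:P%:P => //; rewrite pt_evalC hornerC. Qed.

Lemma ord_ge_cst (R : place cst) c : ord_ge R 0 (cst c).
Proof.
have [->|c0] := eqVneq c 0; first by left; rewrite cstE !rmorph0.
by right; rewrite ord_cst.
Qed.

Lemma ord_ge_poly_x (R : place cst) q : ord_ge R 0 x -> ord_ge R 0 (j q%:P).
Proof.
move=> Rx; elim/poly_ind: q => [|q c Rq]; first by left; rewrite !rmorph0.
rewrite polyCD polyCM rmorphD rmorphM; apply: ord_geD => //; last first.
  by rewrite -cstE; apply: ord_ge_cst.
by rewrite -[0]addr0; apply: ord_geM.
Qed.

Lemma ord_ge_poly (R : place cst) p : ord_ge R 0 x -> ord_ge R 0 y -> ord_ge R 0 (j p).
Proof.
move=> Rx Ry; elim/poly_ind: p => [|p c Rp]; first by left; rewrite rmorph0.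
rewrite rmorphD rmorphM; apply: ord_geD => //; last exact: ord_ge_poly_x.
by rewrite -[0]addr0; apply: ord_geM.
Qed.

(** The whole maximal ideal of (a, b) has positive order, which is the form required by the local
    ring construction; [centered_atP] deduces it from the values of x and y. *)
Definition centered_at (R : place cst) (a b : k) : Prop :=
  forall p, pt_eval a b p = 0 -> ord_ge R 1 (j p).

Lemma centered_atP (R : place cst) a b :
  value_at R x a -> value_at R y b -> centered_at R a b.
Proof.
move=> Rx Ry.
have regc (g : L) c : value_at R g c -> ord_ge R 0 g.
  move=> Rg; rewrite -(subrK (cst c) g); apply: ord_geD => //; last exact: ord_ge_cst.
  exact: (@ord_geW _ _ _ R 0 1 _ ler01 Rg).
move=> p ep; have [q1 [q2]] := pt_eval_decomp a b p; rewrite ep !polyC0 add0r => ->.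
have reg q : ord_ge R 0 (j q) by apply: ord_ge_poly; [apply: regc Rx | apply: regc Ry].
rewrite rmorphD !rmorphM; apply: ord_geD => //.
  by rewrite -[1]add0r; apply: ord_geM => //; rewrite rmorphB /= -cstE.
by rewrite -[1]add0r; apply: ord_geM => //; rewrite polyCB rmorphB /= -cstE.
Qed.

Lemma centered_at_x (R : place cst) a b : centered_at R a b -> value_at R x a.
Proof.
by move=> Rab; rewrite /value_at cstE -rmorphB; apply: Rab; rewrite -polyCB pt_evalC !hornerE subrr.
Qed.

Lemma centered_at_y (R : place cst) a b : centered_at R a b -> value_at R y b.
Proof.
move=> Rab; rewrite /value_at cstE -rmorphB; apply: Rab.
by rewrite /pt_eval !hornerE subrr.
Qed.

Section AffinePoint.
Variables (a b : k).
Hypotheses (ab : b ^+ d = F.[a]) (smooth : b = 0 -> F^`().[a] != 0).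

Local Notation xa := (('X - a%:P)%:P : {poly {poly k}}).

Lemma model_xa_neq0 : j xa != 0.
Proof. by rewrite model_C_neq0 // polyXsubC_eq0. Qed.

(** Write F - F(a) = F1 (x - a). If b = 0 then y^d = (x - a) F1 with F1(a) = F'(a) nonzero, so y
    generates the maximal ideal. Otherwise (y - b) U = (x - a) F1 with U(a, b) = d b^(d-1) nonzero,
    so x - a does. By [model_dvd] every nonzero p divides some G(x) (x - a)^m with G(a) nonzero,
    which bounds its order. *)
Lemma uniformizer_ex : exists pi : {poly {poly k}},
  [/\ j pi != 0, pt_eval a b pi = 0,
      forall p, pt_eval a b p = 0 ->
        exists u q, pt_eval a b u != 0 /\ j u * j p = j pi * j q,
      forall p, j p != 0 -> exists E s q,
        pt_eval a b s != 0 /\ j s * j pi ^+ E = j p * j q &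
      pi = if b == 0 then 'X else xa].
Proof.
have [F1 EF] : exists F1, F - F.[a]%:P = F1 * ('X - a%:P).
  by apply/factor_theorem; rewrite /root !hornerE subrr.
have dvd_xa p : j p != 0 -> exists m G q,
    pt_eval a b G%:P != 0 /\ j G%:P * j xa ^+ m = j p * j q.
  move=> /model_dvd[D [q [D0 E]]].
  have [m [G nG DE]] := multiplicity_XsubC D a; rewrite D0 in nG.
  exists m, G, q; rewrite pt_evalC; split=> //.
  by rewrite E DE polyCM rmorphM -rmorphXn -polyC_exp.
have [b0|b0] := eqVneq b 0.
  have EF1 : y ^+ d = j xa * j F1%:P.
    by rewrite model_y -rmorphM -polyCM mulrC -EF -ab b0 expr0n gtn_eqF // subr0.
  have F1a : F1.[a] != 0.
    have := smooth b0; rewrite -(subr0 F) -(polyC0) -(_ : F.[a] = 0) ?EF.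
      by rewrite derivM !derivE !hornerE subrr mulr0 add0r.
    by rewrite -ab b0 expr0n gtn_eqF.
  exists 'X; split=> //.
  - exact: model_y_neq0.
  - by rewrite pt_evalX.
  - move=> p ep; have [q1 [q2]] := pt_eval_decomp a b p.
    rewrite ep b0 !polyC0 add0r subr0 => ->.
    exists F1%:P, (F1%:P * q1 + 'X^(d.-1) * q2%:P); rewrite pt_evalC; split=> //.
    transitivity (y * (j F1%:P * j q1) + j xa * j F1%:P * j q2%:P).
      by rewrite (rmorphD j) !(rmorphM j); ring.
    by rewrite -EF1 -{1}(prednK d_gt0) exprS (rmorphD j) !(rmorphM j) (rmorphXn j); ring.
  move=> p /dvd_xa[m [G [q [eG E]]]].
  (* The exponent comes from y^(d m) = (x - a)^m F1^m. *)
  exists (d * m)%N, G%:P, (q * F1%:P ^+ m); split=> //.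
  by rewrite exprM EF1 exprMn mulrA E (rmorphM j) (rmorphXn j); ring.
exists xa; split=> //.
- exact: model_xa_neq0.
- by rewrite pt_evalC !hornerE subrr.
- move=> p ep; have [q1 [q2]] := pt_eval_decomp a b p.
  rewrite ep !polyC0 add0r => ->.
  pose U : {poly {poly k}} := \sum_(i < d) 'X ^+ (d.-1 - i) * b%:P%:P ^+ i.
  have EU : j ('X - b%:P%:P) * j U = j xa * j F1%:P.
    rewrite -rmorphM -subrXX rmorphB rmorphXn /= model_y -!polyC_exp ab.
    by rewrite -rmorphB -polyCB EF polyCM rmorphM mulrC.
  exists U, (F1%:P * q1 + q2%:P * U); split; last first.
    transitivity (j q1 * (j ('X - b%:P%:P) * j U) + j q2%:P * j xa * j U).
      by rewrite (rmorphD j) !(rmorphM j); ring.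
    by rewrite EU (rmorphD j) !(rmorphM j); ring.
  rewrite rmorph_sum (eq_bigr (fun i : 'I_d => b ^+ (d.-1 - i) * b ^+ i)) => [|i _].
    by rewrite sum_expr_same -mulr_natl mulf_neq0 // expf_neq0.
  by rewrite rmorphM !rmorphXn /= pt_evalX pt_evalC hornerC.
move=> p /dvd_xa[m [G [q [eG E]]]]; by exists m, G%:P, q.
Qed.

Lemma affine_place_ex : exists R : place cst, centered_at R a b.
Proof.
have [pi [jpi epi ev_dvd dvd_exp _]] := uniformizer_ex.
have [R Rev] := @local_place_ex _ _ _ _ j (pt_eval a b) pi L_unit
  (model_cst_lift a b) (model_ev_ker ab) model_quotient jpi epi ev_dvd dvd_exp.
by exists R.
Qed.

Lemma affine_place_uniq (R1 R2 : place cst) :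
  centered_at R1 a b -> centered_at R2 a b -> R1 = R2.
Proof.
have [pi [jpi epi ev_dvd dvd_exp _]] := uniformizer_ex.
exact: (@local_place_uniq _ _ _ _ j (pt_eval a b) pi L_unit
  (model_cst_lift a b) (model_ev_ker ab) model_quotient jpi epi ev_dvd dvd_exp).
Qed.

Lemma ord_unit (R : place cst) p :
  centered_at R a b -> pt_eval a b p != 0 -> ord R (j p) = 0.
Proof.
move=> Rab ep; have [pi [jpi epi ev_dvd dvd_exp _]] := uniformizer_ex.
apply: (@place_local_ord _ _ _ _ j (pt_eval a b) pi L_unit
  (model_cst_lift a b) (model_ev_ker ab) model_quotient jpi epi ev_dvd dvd_exp) => //.
exact: local_ord_cst.
Qed.

Lemma ord_uniformizer (R : place cst) : centered_at R a b ->
  ord R (j (if b == 0 then 'X else xa)) = 1.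
Proof.
have [pi [jpi epi ev_dvd dvd_exp <-]] := uniformizer_ex.
exact: (@place_ord_pi _ _ _ _ j (pt_eval a b) pi L_unit
  (model_cst_lift a b) (model_ev_ker ab) model_quotient jpi epi ev_dvd dvd_exp).
Qed.

(** When b = 0 the projection to the x-line is totally ramified: y has order 1 and y^d = F1 (x - a)
    with F1 a unit. *)
Lemma ord_xa (R : place cst) : centered_at R a b ->
  ord R (j xa) = if b == 0 then d else 1.
Proof.
move=> Rab; have := ord_uniformizer Rab; case: eqP => // b0 oy.
have [F1 EF] : exists F1, F = F1 * ('X - a%:P).
  by apply/factor_theorem; rewrite /root -ab b0 expr0n gtn_eqF.
have F1a : F1.[a] != 0.
  by have := smooth b0; rewrite EF derivM !derivE !hornerE subrr mulr0 add0r.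
have F10 : F1 != 0 by apply: contraNneq F1a => ->; rewrite horner0.
have : ord R (y ^+ d) = d by rewrite ordX ?model_y_neq0 // oy; lia.
rewrite model_y EF polyCM rmorphM ordM ?model_C_neq0 ?polyXsubC_eq0 //.
by rewrite ord_unit ?pt_evalC // add0r.
Qed.

End AffinePoint.

End AffineModel.

(** * The point at infinity *)

Section Infinity.
Variables (k : fieldType) (d : nat) (F : {poly k}) (L : comUnitRingType).
Variables (j : {rmorphism {poly {poly k}} -> L}) (cst : k -> L).
Hypotheses (M : affine_model d F j) (cstE : forall c, cst c = j c%:P%:P).
Hypotheses (d_gt1 : (1 < d)%N) (cop : coprime (size F).-1 d).

Local Notation x := (j 'X%:P).
Local Notation y := (j 'X).
Local Notation n := (size F).-1.

Let L_unit := model_unit M.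

Lemma coprime_size_gt1 : (1 < size F)%N.
Proof.
have : n != 0%N by apply: contraTneq cop => ->; rewrite /coprime gcd0n gtn_eqF.
by case: (size F) => [|[]].
Qed.

Section PlaceAtInfinity.
Variable O : place cst.
Hypothesis O_inf : ~ (ord_ge O 0 x /\ ord_ge O 0 y).

(** If x were regular then so would be y^d = F(x), hence y. *)
Lemma infinity_ord_x_lt0 : ord O x < 0.
Proof.
rewrite ltNge; apply/negP => x_ge0; have Ox : ord_ge O 0 x by right.
apply: O_inf; split=> //; right.
have : 0 <= ord O (y ^+ d).
  rewrite (model_y M); apply: ord_geP; last exact: ord_ge_poly_x cstE _ _ Ox.
  by apply: (model_C_neq0 M d_gt1); rewrite -size_poly_gt0 ltnW // coprime_size_gt1.
by rewrite (ordX L_unit) ?(model_y_neq0 M) // pmulrn_lge0 // ltnW.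
Qed.

Lemma infinity_ord_poly_x q : q != 0 -> ord O (j q%:P) = ord O x *+ (size q).-1.
Proof.
have x0 : x != 0 by rewrite (model_C_neq0 M) // polyX_eq0.
elim/poly_ind: q => [|q c IHq]; first by rewrite eqxx.
have [->|q0] := eqVneq q 0.
  rewrite mul0r add0r => c0; rewrite -cstE ord_cst; last by rewrite -polyC_eq0.
  by rewrite size_polyC; case: (_ != _).
move=> _; rewrite size_MXaddC (negPf q0) /= polyCD polyCM (rmorphD j) (rmorphM j).
have qx0 : j q%:P * x != 0 by rewrite (unit_mulf_neq0 L_unit) // (model_C_neq0 M).
have ordqx : ord O (j q%:P * x) = ord O x *+ size q.
  rewrite ordM ?x0 ?(model_C_neq0 M) // IHq // -mulrSr prednK //.
  by rewrite size_poly_gt0.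
have [||_ ->] := @ord_addl _ _ _ L_unit O (j q%:P * x) (j c%:P%:P) => //.
rewrite -cstE; apply: ord_geW (ord_ge_cst cstE O c).
rewrite ordqx lezD1 pmulrn_llt0 ?infinity_ord_x_lt0 //.
by rewrite size_poly_gt0.
Qed.

(** From y^d = F(x) one gets d ord(y) = n ord(x). Coprimality leaves a common factor t, which
    normalization later forces to be 1. *)
Lemma infinity_ord_multiple : exists2 t : nat, (0 < t)%N &
  ord O x = - (d * t)%N%:Z /\ ord O y = - (n * t)%N%:Z.
Proof.
have x_lt0 := infinity_ord_x_lt0.
have F0 : F != 0 by rewrite -size_poly_gt0 ltnW // coprime_size_gt1.
have E : ord O y *+ d = ord O x *+ n.
  by rewrite -(ordX L_unit) ?(model_y_neq0 M) // (model_y M) infinity_ord_poly_x.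
have n_gt0 : (0 < n)%N by have := coprime_size_gt1; case: (size F) => [|[]].
have y_lt0 : ord O y < 0.
  by rewrite -(pmulrn_llt0 _ (ltnW d_gt1)) E pmulrn_llt0.
have [X EX] : exists X : nat, ord O x = - X%:Z by exists `|ord O x|%N; lia.
have [Y EY] : exists Y : nat, ord O y = - Y%:Z by exists `|ord O y|%N; lia.
rewrite EX EY in E x_lt0 y_lt0 *.
have {}E : (Y * d)%N = (X * n)%N by move: E; rewrite !pmulrn !mulrzz; lia.
have /dvdnP[t Et] : (d %| X)%N.
  by rewrite -(@Gauss_dvdl d X n) 1?coprime_sym // -E dvdn_mull.
exists t; first by move: x_lt0; rewrite Et; case: (t) => //; rewrite mul0n.
split; first by rewrite Et mulnC.
have : (Y * d = n * t * d)%N by rewrite E Et; lia.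
by move=> /eqP; rewrite eqn_pmul2r ?(ltnW d_gt1) // => /eqP->.
Qed.

(** The pole order of the term a_i(x) y^i when x and y have orders - d and - n. *)
Definition pole_weight (p : {poly {poly k}}) (i : nat) : nat :=
  d * (size p`_i).-1 + n * i.

Definition is_pole_order (p : {poly {poly k}}) (w : nat) : Prop :=
  exists i, [/\ (i < d)%N, p`_i != 0, w = pole_weight p i &
    forall i', (i' < d)%N -> p`_i' != 0 -> (pole_weight p i' <= w)%N].

Lemma is_pole_order_uniq p w1 w2 : is_pole_order p w1 -> is_pole_order p w2 -> w1 = w2.
Proof.
move=> [i1 [d1 p1 E1 m1]] [i2 [d2 p2 E2 m2]]; apply/eqP.
by rewrite eqn_leq {1}E1 {2}E2 m1 // m2.
Qed.

Lemma poly_sum_coef (p : {poly {poly k}}) m : (size p <= m)%N ->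
  j p = \sum_(i < m) j (p`_i)%:P * y ^+ i.
Proof.
move=> sp; have {1}-> : p = \sum_(i < m) (p`_i)%:P * 'X^i.
  rewrite -{1}[p](@take_poly_id _ m) // /take_poly poly_def.
  by apply: eq_bigr => i _; rewrite mul_polyC.
by rewrite rmorph_sum; apply: eq_bigr => i _; rewrite (rmorphM j) (rmorphXn j).
Qed.

Lemma infinity_ord_multiple_poly t : (0 < t)%N ->
    ord O x = - (d * t)%N%:Z -> ord O y = - (n * t)%N%:Z ->
  forall p : {poly {poly k}}, p != 0 -> (size p <= d)%N ->
  exists2 w, is_pole_order p w & ord O (j p) = - (w * t)%N%:Z.
Proof.
move=> t_gt0 Ex Ey p p0 sp; rewrite (poly_sum_coef sp).
pose T i := j (p`_i)%:P * y ^+ i.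
have yX i : y ^+ i != 0 by rewrite (unit_expf_neq0 L_unit) // (model_y_neq0 M).
have T0 i : (T i != 0) = (p`_i != 0).
  apply/idP/idP; first by apply: contraNneq => pi0; rewrite /T pi0 !rmorph0 mul0r.
  by move=> pi0; rewrite (unit_mulf_neq0 L_unit) // (model_C_neq0 M).
have ordT i : T i != 0 -> ord O (T i) = - (pole_weight p i * t)%N%:Z.
  rewrite T0 => pi0; rewrite /T ordM ?(model_C_neq0 M) //.
  rewrite infinity_ord_poly_x // (ordX L_unit) ?(model_y_neq0 M) // Ex Ey /pole_weight.
  rewrite !mulNrn -opprD; congr (- _); rewrite !pmulrn !mulrzz; nia.
(* Equal weights make n i and n i' congruent modulo d; n is prime to d and both indices are below
   d. *)
have T_inj i i' : (i < d)%N -> (i' < d)%N -> T i != 0 -> T i' != 0 ->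
    ord O (T i) = ord O (T i') -> i = i'.
  move=> id i'd Ti Ti'; rewrite !ordT // => /oppr_inj[] /eqP.
  rewrite eqn_pmul2r // => /eqP E.
  have : n * i = n * i' %[mod d].
    by move/(congr1 (modn^~ d)): E; rewrite /pole_weight !(mulnC d) !modnMDl.
  wlog le_ii' : i i' id i'd {Ti Ti' E} / (i <= i')%N => [wl|] Emod.
    by have [/wl->//|/ltnW/wl->] := leqP i i'.
  move/eqP: Emod; rewrite eq_sym eqn_mod_dvd ?leq_mul2l ?le_ii' ?orbT // -mulnBr.
  rewrite Gauss_dvdr 1?coprime_sym // => /dvdnP[[|s]]; first by lia.
  by nia.
case: (ord_sum_distinct L_unit T_inj) => [allT0|[i [id Ti S0 SE Smin]]].
  case/eqP: p0; apply/polyP => i; rewrite coef0.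
  have [id|di] := ltnP i d; last by rewrite nth_default // (leq_trans sp).
  by apply/eqP/negPn; rewrite -T0 allT0 // eqxx.
exists (pole_weight p i); last by rewrite SE ordT.
exists i; split=> // [|i' i'd pi']; first by rewrite -T0.
have Ti' : T i' != 0 by rewrite T0.
by have := Smin _ i'd Ti'; rewrite !ordT // lerN2 lez_nat leq_pmul2r.
Qed.

Lemma infinity_ord (p : {poly {poly k}}) : p != 0 -> (size p <= d)%N ->
  exists2 w, is_pole_order p w & ord O (j p) = - w%:Z.
Proof.
have [t t_gt0 [Ex Ey]] := infinity_ord_multiple.
have ordp := infinity_ord_multiple_poly t_gt0 Ex Ey.
(* All orders are multiples of t, and the order 1 occurs. *)
suff t1 : t = 1%N by move=> p0 /(ordp _ p0)[w pw ->]; exists w; rewrite ?t1 ?muln1.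
have [g g1] := ord_normalized O.
have g0 : g != 0 by apply: contra_eq_neq g1 => ->; rewrite Defs.ord0.
have [D [q [D0 sq E]]] := model_frac M g.
have q0 : q != 0.
  apply: contra_neq g0 => q0; apply: (unit_mulIf L_unit (model_C_neq0 M d_gt1 D0)).
  by rewrite E q0 rmorph0 mul0r.
have [w _ ow] := ordp _ q0 sq.
have := congr1 (ord O) E; rewrite ordM ?(model_C_neq0 M) // g1 ow.
rewrite infinity_ord_poly_x // Ex mulNrn pmulrn mulrzz => E1.
have : (t %| 1)%N.
  suff : (t%:Z %| 1)%Z by [].
  by apply/dvdzP; exists (d%:Z * (size D).-1%:Z - w%:Z); lia.
by rewrite dvdn1 => /eqP.
Qed.

End PlaceAtInfinity.

(** Pole orders depend on the polynomial only, and every function is a quotient of two reduced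
    polynomials. *)
Lemma infinity_uniq (O O' : place cst) :
    ~ (ord_ge O 0 x /\ ord_ge O 0 y) -> ~ (ord_ge O' 0 x /\ ord_ge O' 0 y) ->
  O = O'.
Proof.
move=> Oinf O'inf; apply: place_eq => g g0.
have [D [q [D0 sq E]]] := model_frac M g.
have jD := model_C_neq0 M d_gt1 D0.
have q0 : q != 0.
  by apply: contra_neq g0 => q0; apply: (unit_mulIf L_unit jD); rewrite E q0 rmorph0 mul0r.
have ordE (p : {poly {poly k}}) : p != 0 -> (size p <= d)%N -> ord O (j p) = ord O' (j p).
  move=> p0 sp; have [[w pw ->] [w' pw' ->]] := (infinity_ord Oinf p0 sp, infinity_ord O'inf p0 sp).
  by rewrite (is_pole_order_uniq pw pw').
have sD : (size D%:P <= d)%N by rewrite size_polyC D0 ltnW.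
have D0' : D%:P != 0 by rewrite polyC_eq0.
have := congr1 (ord O) E; have := congr1 (ord O') E.
by rewrite !ordM // (ordE _ D0' sD) (ordE _ q0 sq) => <- /addIr.
Qed.

End Infinity.

(** * Functions regular on the affine curve *)

(** The derivative d X^(d-1) vanishes only at 0, which is not a root of X^d - c. *)
Lemma root_uniq_XnsubC (K : closedFieldType) d (c : K) :
    (0 < d)%N -> d%:R != 0 :> K -> c != 0 ->
  exists rs : seq K, [/\ uniq rs, size rs = d & forall b, b \in rs -> b ^+ d = c].
Proof.
move=> d_gt0 d0 c0; have [rs Ers] := closed_field_poly_normal ('X^d - c%:P).
rewrite (monicP (monicXnsubC c d_gt0)) scale1r in Ers.
exists rs; split.
- rewrite -separable_prod_XsubC -Ers unlock.
  apply/Pdiv.ClosedField.coprimepP => b; rewrite /root !derivE subr0 !hornerE.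
  rewrite subr_eq0 => /eqP bc; rewrite hornerMn hornerXn -mulr_natl mulf_neq0 //.
  apply: contra_neq c0 => /eqP; rewrite -bc expf_eq0 => /andP[_ /eqP ->].
  by rewrite expr0n gtn_eqF.
- by have := congr1 (size \o val) Ers; rewrite /= size_XnsubC // size_prod_XsubC => -[].
move=> b; rewrite -root_prod_XsubC -Ers /root !hornerE subr_eq0.
by move/eqP.
Qed.

Section Integrality.
Variables (K : closedFieldType) (d : nat) (F : {poly K}) (L : comUnitRingType).
Variables (j : {rmorphism {poly {poly K}} -> L}) (cst : K -> L).
Hypotheses (M : affine_model d F j) (cstE : forall c, cst c = j c%:P%:P).
Hypotheses (d_gt1 : (1 < d)%N) (d_neq0 : d%:R != 0 :> K).
Hypothesis smooth : forall a, F.[a] = 0 -> F^`().[a] != 0.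

Local Notation x := (j 'X%:P).
Local Notation y := (j 'X).

Let L_unit := model_unit M.
Let d_gt0 : (0 < d)%N. Proof. exact: ltnW. Qed.

Let smooth_at a b : b ^+ d = F.[a] -> b = 0 -> F^`().[a] != 0.
Proof. by move=> ab b0; apply: smooth; rewrite -ab b0 expr0n gtn_eqF. Qed.

Lemma centered_regular (R : place cst) a b : centered_at j R a b ->
  ord_ge R 0 x /\ ord_ge R 0 y.
Proof.
move=> Rab; split.
  rewrite -(subrK (cst a) x); apply: ord_geD; last exact: ord_ge_cst cstE R a.
  exact: (@ord_geW _ _ _ R 0 1 _ ler01 (centered_at_x cstE Rab)).
rewrite -(subrK (cst b) y); apply: ord_geD; last exact: ord_ge_cst cstE R b.
exact: (@ord_geW _ _ _ R 0 1 _ ler01 (centered_at_y cstE Rab)).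
Qed.

Let ge_poly_x (R : place cst) (q : {poly K}) : ord_ge R 0 x -> ord_ge R 0 (j q%:P).
Proof. by move=> Rx; have := ord_ge_poly_x cstE q Rx. Qed.

Section RegularFunction.
Variable h : L.
Hypothesis h_regular : forall R : place cst,
  ord_ge R 0 x -> ord_ge R 0 y -> ord_ge R 0 h.

(** The function p = h D vanishes at every point above a. If F(a) is nonzero there are d such
    points, and p(a, Y), of degree less than d, has d roots. If F(a) = 0 there is one point, where y
    has order 1 and h D has order at least d. *)
Lemma regular_coef_root (D : {poly K}) (p : {poly {poly K}}) a :
    D.[a] = 0 -> (size p <= d)%N -> h * j D%:P = j p ->
  forall i, root p`_i a.
Proof.
move=> Da sp E; have [Fa|Fa] := eqVneq F.[a] 0; last first.
  have [rs [urs srs rsP]] := root_uniq_XnsubC d_gt0 d_neq0 Fa.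
  suff pa0 : map_poly (horner_eval a) p = 0.
    by move=> i; have := coef_map (horner_eval a) p i; rewrite pa0 coef0 => /esym/rootP.
  apply: contraTeq (leqnn d) => pa0; rewrite -ltnNge.
  have sz : (size (map_poly (horner_eval a) p) <= d)%N := leq_trans (size_poly _ _) sp.
  apply: leq_trans sz; rewrite -{1}srs; apply: max_poly_roots => //.
  apply/allP => b /rsP ab; have [R Rab] := affine_place_ex M cstE d_gt1 d_neq0 ab (smooth_at ab).
  have [Rx Ry] := centered_regular Rab.
  have : ord_ge R 1 (j p).
    rewrite -E -[1]add0r; apply: ord_geM; first exact: h_regular.
    by apply: Rab; rewrite pt_evalC.
  rewrite /root -[b](_ : horner_eval a b%:P = b); last by rewrite /= /horner_eval hornerC.
  rewrite horner_map /=; apply: contraPT => ep.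
  have jp : j p != 0 by apply: contraNneq ep => /(model_ev_ker M d_gt1 ab) /eqP.
  move/(ord_geP jp); rewrite (ord_unit M cstE d_gt1 d_neq0 ab (smooth_at ab) Rab ep).
  by [].
have ab : 0 ^+ d = F.[a] by rewrite expr0n gtn_eqF.
have [R Rab] := affine_place_ex M cstE d_gt1 d_neq0 ab (smooth_at ab).
have [Rx Ry] := centered_regular Rab.
have oxa := ord_xa M cstE d_gt1 d_neq0 ab (smooth_at ab) Rab.
have oy := ord_uniformizer M cstE d_gt1 d_neq0 ab (smooth_at ab) Rab.
rewrite eqxx in oxa oy.
have ge_xa q : root q a -> ord_ge R d%:Z (j q%:P).
  move=> /factor_theorem[q1 ->]; rewrite polyCM (rmorphM j) -[d%:Z]add0r.
  apply: ord_geM; first exact: ge_poly_x.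
  by right; rewrite oxa.
have ge_p : ord_ge R d%:Z (j p).
  rewrite -E -[d%:Z]add0r; apply: ord_geM; first exact: h_regular.
  by apply: ge_xa; apply/rootP.
(* By induction the terms of index m < i have order at least d > i, and those of index m > i have
   order at least m. If a were not a root of the i-th coefficient, p would have order i < d. *)
move=> i; elim/ltn_ind: i => i IHi.
have [id|di] := ltnP i d; last by rewrite nth_default ?root0 // (leq_trans sp).
apply: contraPT ge_p => pia.
have yX m : y ^+ m != 0 by rewrite (unit_expf_neq0 L_unit) // (model_y_neq0 M).
have yge m : ord_ge R m%:Z (y ^+ m).
  by right; rewrite (ordX L_unit) ?(model_y_neq0 M) // oy; lia.
have ci : pt_eval a 0 (p`_i)%:P != 0 by rewrite pt_evalC.
have pi0 : p`_i != 0 by apply: contraNneq pia => ->; rewrite root0.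
have jpi : j (p`_i)%:P != 0 by rewrite (model_C_neq0 M).
have oi : ord R (j (p`_i)%:P * y ^+ i) = i%:Z.
  rewrite ordM // (ordX L_unit) ?(model_y_neq0 M) // oy.
  by rewrite (ord_unit M cstE d_gt1 d_neq0 ab (smooth_at ab) Rab ci); lia.
rewrite (poly_sum_coef j sp) (bigD1 (Ordinal id)) //=.
have [||S0 oS] := ord_addl L_unit (P := R) (g := j (p`_i)%:P * y ^+ i)
    (h := \sum_(m < d | m != Ordinal id) j (p`_m)%:P * y ^+ m).
- by rewrite (unit_mulf_neq0 L_unit).
- rewrite oi; elim/big_ind: _ => [||m mi]; [by left | exact: ord_geD|].
  have [lt_mi|lt_im|eq_mi] := ltngtP m i.
  + rewrite -[i%:Z + 1]addr0; apply: ord_geM.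
      by apply: ord_geW (ge_xa _ (IHi _ lt_mi)); lia.
    by apply: ord_geW (yge m).
  + rewrite -[i%:Z + 1]add0r; apply: ord_geM.
      exact: ge_poly_x.
    by apply: ord_geW (yge m); lia.
  by case/eqP: mi; apply: val_inj.
by move/(ord_geP S0); rewrite oS oi; lia.
Qed.

(** By [regular_coef_root] each linear factor of the denominator cancels, until the denominator is
    constant. *)
Lemma regular_polynomial :
  exists2 p : {poly {poly K}}, (size p <= d)%N & h = j p.
Proof.
have [D [p [D0 sp E]]] := model_frac M h.
elim: {D}(size D) {-2}D (leqnn (size D)) D0 p sp E => [|m IHm] D sD D0 p sp E.
  by move: sD; rewrite leqn0 size_poly_eq0 (negPf D0).
have [sD1|sD1] := eqVneq (size D) 1%N.
  have [c c0 Dc] := size_poly1P _ (introT eqP sD1).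
  exists (c^-1%:P%:P * p).
    by apply: leq_trans sp; rewrite mul_polyC; apply: size_scale_leq.
  by rewrite (rmorphM j) -E Dc mulrCA -(rmorphM j) -!polyCM mulVf // !rmorph1 mulr1.
have [a Da] := closed_rootP D sD1.
have pa := regular_coef_root (rootP Da) sp E.
have [D1 ED] := factor_theorem _ _ Da.
pose p1 := \poly_(i < d) (p`_i %/ ('X - a%:P)).
have Ep : p = p1 * ('X - a%:P)%:P.
  apply/polyP => i; rewrite coefMC coef_poly; case: ltnP => [_|di].
    by rewrite divpK // dvdp_XsubCl.
  by rewrite mul0r nth_default // (leq_trans sp).
apply: (IHm D1 _ _ p1).
- by move: sD; rewrite ED size_Mmonic ?monicXsubC ?size_XsubC ?addn2 //;
    apply: contraNneq D0 => D10; rewrite ED D10 mul0r.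
- by apply: contraNneq D0 => D10; rewrite ED D10 mul0r.
- exact: size_poly.
apply: (unit_mulIf L_unit (model_xa_neq0 M d_gt1 a)).
by rewrite -mulrA -!(rmorphM j) -polyCM -ED -Ep.
Qed.

End RegularFunction.

Lemma regular_outside_infinity (O : place cst) (h : L) :
    coprime (size F).-1 d -> ~ (ord_ge O 0 x /\ ord_ge O 0 y) ->
    h != 0 -> (forall R, R <> O -> 0 <= ord R h) ->
  exists (p : {poly {poly K}}) w,
    [/\ (size p <= d)%N, h = j p, is_pole_order d F p w & ord O h = - w%:Z].
Proof.
move=> cop Oinf h0 hreg; have [|p sp hp] := @regular_polynomial h.
  by move=> R Rx Ry; right; apply: hreg => RO; apply: Oinf; rewrite -RO.
have p0 : p != 0 by apply: contra_neq h0 => p0; rewrite hp p0 rmorph0.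
have [w pw ow] := infinity_ord M cstE d_gt1 cop Oinf p0 sp.
by exists p, w; split=> //; rewrite hp.
Qed.

End Integrality.

(** * Multiples of a point in the Jacobian *)

Section JacobianMultiples.
Variables (K : closedFieldType) (L : comUnitRingType) (cst : K -> L).
Hypothesis L_unit : forall g : L, g != 0 -> g \is a GRing.unit.

(** The divisor of h is i (P - O); the two boolean terms cancel when P = O. *)
Definition principal_mult (O P : place cst) (i : nat) : Prop :=
  exists2 h : L, h != 0 &
    forall R, ord R h = i%:Z *+ (P == R) - i%:Z *+ (O == R).

Lemma abel_jacobi_mulrn_eq0 (O P : place cst) i :
  abel_jacobi O P *+ i = 0 <-> principal_mult O P i.
Proof.
pose D := Div0 (place_diff_degree0 O P).
have EI : (abel_jacobi O P *+ i == 0) = (D *+ i \in principal (cst := cst)).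
  rewrite -[D *+ i]subr0 -/(principal_divisors cst).
  have -> : (D *+ i - 0 \in principal (cst:=cst)) = (D *+ i - 0 \in principal_divisors cst) by [].
  rewrite Quotient.idealrBE /abel_jacobi -/D.
  by rewrite -(raddfMn (\pi_(Quotient.quot (principal_divisors cst)))%qT) raddf0.
have coefD R : coeff R (divisor (D *+ i)) = i%:Z *+ (P == R) - i%:Z *+ (O == R).
  have -> : divisor (D *+ i) = (<< P >> - << O >>) *+ i.
    exact: (raddfMn (\val : div0 cst -> _) i D).
  by rewrite coeffMn coeffB !coeffU !mul1r mulrnBl -!mulrnA ![(_ * i)%N]mulnC !mulrnA !natz.
split=> [/eqP|[h h0 hD]].
  rewrite EI => /asboolP[h uh hD]; exists h => [|R]; last by rewrite -hD coefD.
  by apply: contraTneq uh => ->; rewrite unitr0.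
apply/eqP; rewrite EI; apply/asboolP; exists h; first exact: L_unit.
by move=> R; rewrite coefD hD.
Qed.

End JacobianMultiples.

(** * Arithmetic of [m0] and [ell0] *)

Section Ell0.
Variables (n d : nat).
Hypotheses (hd : (2 <= d < n)%N) (hnd : coprime n d).

(** m0 is the largest multiple of d not exceeding n + d; equality would make d divide n. *)
Lemma m0_bounds : (n < m0 n d)%N /\ (m0 n d < n + d)%N.
Proof.
have [d2 dn] := andP hd; have d_gt0 : (0 < d)%N by apply: ltnW.
rewrite /m0 /ell0 mulnC; split.
  have := ltn_ceil (n + d) d_gt0; rewrite mulSn; lia.
rewrite ltn_neqAle leq_divM andbT; apply: contraTneq hnd => E.
have : (d %| n + d)%N by rewrite -E dvdn_mull.
rewrite dvdn_addl // => /gcdn_idPr; rewrite /coprime => ->.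
by rewrite gtn_eqF.
Qed.

Lemma ell0_gt1 : (1 < ell0 n d)%N.
Proof.
have [lt_nm _] := m0_bounds; rewrite /m0 in lt_nm.
by have [d2 dn] := andP hd; case: (ell0 n d) lt_nm => [|[|]] //; lia.
Qed.

End Ell0.

(** * Principal multiples of an affine point *)

Section TorsionPoints.
Variables (K : closedFieldType) (n d : nat) (F : {poly K}) (L : comUnitRingType).
Variables (j : {rmorphism {poly {poly K}} -> L}) (cst : K -> L).
Hypotheses (M : affine_model d F j) (cstE : forall c, cst c = j c%:P%:P).
Hypotheses (hd : (2 <= d < n)%N) (hnd : coprime n d) (sF : size F = n.+1).
Hypothesis d_neq0 : d%:R != 0 :> K.
Hypothesis smooth : forall a, F.[a] = 0 -> F^`().[a] != 0.

Local Notation x := (j 'X%:P).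
Local Notation y := (j 'X).
Local Notation m := (m0 n d).
Local Notation ell := (ell0 n d).

Let L_unit := model_unit M.
Let d_gt1 : (1 < d)%N. Proof. by case/andP: hd. Qed.
Let d_gt0 : (0 < d)%N. Proof. exact: ltnW. Qed.
Let cop : coprime (size F).-1 d. Proof. by rewrite sF. Qed.

Let smooth_at a b : b ^+ d = F.[a] -> b = 0 -> F^`().[a] != 0.
Proof. by move=> ab b0; apply: smooth; rewrite -ab b0 expr0n gtn_eqF. Qed.

(** Since b is nonzero, x - a is a uniformizer, so the order of q(x) is a root multiplicity and is
    at most its degree. *)
Lemma ord_poly_x_root_mult (P : place cst) a b (q : {poly K}) :
    centered_at j P a b -> b ^+ d = F.[a] -> b != 0 -> q != 0 ->
  exists r G, [/\ q = G * ('X - a%:P) ^+ r, ord P (j q%:P) = r%:Z & (r < size q)%N].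
Proof.
move=> Pab ab b0 q0; have [r [G Ga Eq]] := multiplicity_XsubC q a.
rewrite q0 /= in Ga; have G0 : G != 0 by apply: contraNneq q0 => G0; rewrite Eq G0 mul0r.
exists r, G; split=> //.
  have jxa := model_xa_neq0 M d_gt1 a.
  rewrite Eq polyCM polyC_exp (rmorphM j) (rmorphXn j) ordM ?(unit_expf_neq0 L_unit) //; last first.
    exact: model_C_neq0 M d_gt1 _ G0.
  rewrite (ordX L_unit) // (ord_xa M cstE d_gt1 d_neq0 ab (smooth_at ab) Pab) (negPf b0).
  rewrite (ord_unit M cstE d_gt1 d_neq0 ab (smooth_at ab) Pab) ?pt_evalC //.
  by rewrite add0r; lia.
rewrite Eq size_Mmonic ?monic_exp ?monicXsubC // size_exp_XsubC.
by move: G0; rewrite -size_poly_gt0; case: (size G) => // s _; rewrite addSn addnS /= ltnS leq_addl.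
Qed.

(** Y^d - F is zero on the curve, so its value b^d - F(a) at P is a constant of positive order. *)
Lemma centered_curve_eq (P : place cst) a b : centered_at j P a b -> b ^+ d = F.[a].
Proof.
move=> Pab; apply/eqP; apply: contraT => ne.
pose e : K := b ^+ d - F.[a]; have e0 : e != 0 by rewrite subr_eq0.
have ce0 : cst e != 0 by rewrite cstE (model_C_neq0 M) // polyC_eq0.
have : ord_ge P 1 (j ('X ^+ d - F%:P - e%:P%:P)).
  by apply: Pab; rewrite /pt_eval !hornerE /e; rewrite ?subrr.
rewrite (rmorphB j) (model_curve M) add0r -cstE => /(ord_geN L_unit).
by rewrite opprK => /(ord_geP ce0); rewrite ord_cst.
Qed.

Lemma polynomial_pole_le (p : {poly {poly K}}) w i :
    is_pole_order d F p w -> (i < d)%N -> p`_i != 0 ->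
  (d * (size (p`_i)%R).-1 + n * i <= w)%N.
Proof. by case=> i' [_ _ _ max_w] id /(max_w _ id); rewrite /pole_weight sF. Qed.

Section FixedPoints.
Variables (O P : place cst) (a b : K).
Hypotheses (O_inf : ~ (ord_ge O 0 x /\ ord_ge O 0 y)) (Pab : centered_at j P a b).

Let ab : b ^+ d = F.[a]. Proof. exact: centered_curve_eq Pab. Qed.

Lemma centered_neq_infinity : P != O.
Proof.
apply/eqP => PO; apply: O_inf; rewrite -PO.
by have := centered_regular cstE Pab.
Qed.

Lemma principal_mult_ord i : principal_mult O P i ->
  exists (h : L) (p : {poly {poly K}}),
    [/\ h = j p, (size p <= d)%N, is_pole_order d F p i, h != 0 & ord P h = i%:Z].
Proof.
case=> h h0 hD; have [|p [w [sp hp pw ow]]] :=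
  regular_outside_infinity M cstE d_gt1 d_neq0 smooth cop O_inf h0.
  move=> R RO; rewrite hD [O == R]eq_sym (introF eqP RO) subr0.
  by case: (P == R).
have OP := centered_neq_infinity.
have := hD P; have := hD O; rewrite !eqxx (negPf OP) [O == P]eq_sym (negPf OP) subr0 sub0r.
rewrite ow => /oppr_inj[Ew] oP.
by exists h, p; split=> //; rewrite -Ew.
Qed.

(** A pole of order i < n leaves no room for y, so the function is a polynomial in x of degree i /
    d, which cannot have a root of multiplicity i. *)
Lemma small_mult_not_principal i : b != 0 -> (0 < i < n)%N -> ~ principal_mult O P i.
Proof.
move=> b0 /andP[i_gt0 i_n] /principal_mult_ord[h [p [hp sp pi h0 oP]]].
have ple := polynomial_pole_le pi.
have Ep : p = (p`_0)%:P.
  apply/polyP => -[|r]; rewrite coefC //=.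
  have [rd|dr] := ltnP r.+1 d; last by rewrite nth_default // (leq_trans sp).
  apply/eqP; apply: contraTT i_n => /(ple _ rd) le_i; rewrite -leqNgt.
  exact: leq_trans (leq_trans (leq_pmulr n (ltn0Sn r)) (leq_addl _ _)) le_i.
have [r [rd pr Ei _]] := pi; have r0 : r = 0%N.
  by move: pr; rewrite Ep coefC; case: (r) => // r'; rewrite eqxx.
rewrite r0 in pr Ei; have := oP; rewrite hp Ep.
have [s [G [_ -> lt_s]]] := ord_poly_x_root_mult Pab ab b0 pr.
move=> [Es]; move: Ei lt_s; rewrite /pole_weight muln0 addn0 Es.
case: (size p`_0) => [|S] //= Ei; rewrite ltnS {1}Ei => dS.
have S0 : S = 0%N by nia.
by move: i_gt0; rewrite Ei S0 muln0.
Qed.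

(** The function is x - a. Wherever else it vanishes, y^d = F1 (x - a) vanishes too, so the place
    lies at (a, 0) and is P. *)
Lemma ramified_principal : b = 0 -> principal_mult O P d.
Proof.
move=> b0; have OP := centered_neq_infinity.
have xa0 : 'X - a%:P != 0 by rewrite polyXsubC_eq0.
have jxa := model_xa_neq0 M d_gt1 a.
exists (j ('X - a%:P)%:P) => // R.
have [PR|PR] := eqVneq P R.
  rewrite -PR [O == P]eq_sym (negPf OP) subr0.
  by rewrite (ord_xa M cstE d_gt1 d_neq0 ab (smooth_at ab) Pab) b0 !eqxx.
have [OR|OR] := eqVneq O R.
  rewrite -OR; have [||w [i [id ci -> _]] ->] :=
    infinity_ord M cstE d_gt1 cop O_inf (p := ('X - a%:P)%:P).
  - by rewrite polyC_eq0.
  - by rewrite size_polyC xa0.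
  move: ci; rewrite coefC; case: i id => [|i] id; last by rewrite eqxx.
  by rewrite /pole_weight coefC /= size_XsubC muln1 muln0 addn0 sub0r.
rewrite !mulr0n subr0; apply/eqP; apply: contraNT PR => oR.
have [Rx Ry] : ord_ge R 0 x /\ ord_ge R 0 y.
  apply/not_notP => R_inf; case/eqP: OR.
  exact: infinity_uniq M cstE d_gt1 cop _ _ O_inf R_inf.
apply/eqP; apply: (affine_place_uniq M cstE d_gt1 d_neq0 ab (smooth_at ab)) => //.
have Rxa : ord_ge R 1 (j ('X - a%:P)%:P).
  right; have /(ord_geP jxa) : ord_ge R 0 (j ('X - a%:P)%:P).
    by have := ord_ge_poly_x cstE ('X - a%:P) Rx.
  by move: oR; rewrite -gtz0_ge1 lt0r => -> ->.
apply: (centered_atP cstE); first by rewrite /value_at cstE -(rmorphB j) -polyCB.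
rewrite /value_at cstE b0 !rmorph0 subr0; right.
have y0 := model_y_neq0 M d_gt1.
have [F1 EF] : exists F1, F = F1 * ('X - a%:P).
  by apply/factor_theorem; rewrite /root -ab b0 expr0n gtn_eqF.
have : ord_ge R 1 (y ^+ d).
  rewrite (model_y M) EF (polyCM F1) (rmorphM j) -[1]add0r; apply: ord_geM => //.
  by have := ord_ge_poly_x cstE F1 Rx.
move/(ord_geP (unit_expf_neq0 L_unit d y0)).
by rewrite (ordX L_unit) // -!gtz0_ge1 pmulrn_lgt0.
Qed.

End FixedPoints.

End TorsionPoints.

(** * The function v(x) - y and its norm *)

Section TorsionForm.
Variables (K : closedFieldType) (n d : nat) (F : {poly K}) (L : comUnitRingType).
Variables (j : {rmorphism {poly {poly K}} -> L}) (cst : K -> L).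
Hypotheses (M : affine_model d F j) (cstE : forall c, cst c = j c%:P%:P).
Hypotheses (hd : (2 <= d < n)%N) (hnd : coprime n d) (sF : size F = n.+1).
Hypothesis d_neq0 : d%:R != 0 :> K.
Hypothesis smooth : forall a, F.[a] = 0 -> F^`().[a] != 0.

Local Notation x := (j 'X%:P).
Local Notation y := (j 'X).
Local Notation m := (m0 n d).
Local Notation ell := (ell0 n d).

Let L_unit := model_unit M.
Let d_gt1 : (1 < d)%N. Proof. by case/andP: hd. Qed.
Let d_gt0 : (0 < d)%N. Proof. exact: ltnW. Qed.
Let cop : coprime (size F).-1 d. Proof. by rewrite sF. Qed.

Let smooth_at a b : b ^+ d = F.[a] -> b = 0 -> F^`().[a] != 0.
Proof. by move=> ab b0; apply: smooth; rewrite -ab b0 expr0n gtn_eqF. Qed.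

(** The product of the other conjugates of v - y over k(x), so that the norm is v^d - F. *)
Definition norm_cofactor (v : {poly K}) : {poly {poly K}} :=
  \sum_(i < d) v%:P ^+ (d.-1 - i) * 'X^i.

Lemma norm_cofactorP (v : {poly K}) : j (v%:P - 'X) * j (norm_cofactor v) = j (v ^+ d - F)%:P.
Proof.
rewrite -(rmorphM j) -subrXX (rmorphB j) (rmorphXn j) (rmorphXn j).
by rewrite (model_y M) (polyCB (v ^+ d)) (rmorphB j) polyC_exp (rmorphXn j).
Qed.

(** The value is d b^(d-1). Hence the whole zero of the norm at (a, b) belongs to v - y. *)
Lemma pt_eval_norm_cofactor (v : {poly K}) a b : v.[a] = b -> b != 0 ->
  pt_eval a b (norm_cofactor v) != 0.
Proof.
move=> va b0.
have -> : pt_eval a b (norm_cofactor v) = \sum_(i < d) b ^+ (d.-1 - i) * b ^+ i.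
  rewrite /norm_cofactor (rmorph_sum (pt_eval a b)); apply: eq_bigr => i _.
  by rewrite [LHS]/= /pt_eval !hornerE va.
by rewrite sum_expr_same -mulr_natl mulf_neq0 // expf_neq0.
Qed.

Lemma y_form_size (v : {poly K}) : (size (v%:P - 'X : {poly {poly K}})%R <= d)%N.
Proof.
rewrite (leq_trans (size_polyD _ _)) // geq_max size_polyN size_polyX d_gt1 andbT.
by rewrite size_polyC (leq_trans (leq_b1 _)).
Qed.

Lemma y_form_neq0 (v : {poly K}) : (v%:P - 'X : {poly {poly K}}) != 0.
Proof.
apply/eqP => /(congr1 (fun p : {poly {poly K}} => p`_1)) /eqP.
by rewrite coefB coefC coefX coef0 sub0r oppr_eq0 oner_eq0.
Qed.

Lemma infinity_ord_y_form (O : place cst) (v : {poly K}) :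
    ~ (ord_ge O 0 x /\ ord_ge O 0 y) -> size v = ell.+1 ->
  ord O (j (v%:P - 'X)) = - m%:Z.
Proof.
move=> O_inf sv.
have [w pw ->] := infinity_ord M cstE d_gt1 cop O_inf (y_form_neq0 v) (y_form_size v).
congr (- Posz _); apply: is_pole_order_uniq pw _.
have v0 : v != 0 by rewrite -size_poly_eq0 sv.
have c0 : (v%:P - 'X : {poly {poly K}})`_0 = v by rewrite coefB coefC coefX subr0.
exists 0%N; rewrite /pole_weight c0; split=> //.
  by rewrite muln0 addn0 sv.
move=> [|[|i]] id; rewrite ?c0 ?sv ?muln0 ?addn0 // coefB coefC coefX /= sub0r.
  move=> _; rewrite size_polyN size_polyC oner_eq0 /= muln0 muln1 sF.
  by have [/ltnW] := m0_bounds hd hnd.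
by rewrite oppr0 eqxx.
Qed.

(** The norm of w - y is B^d x^m0, so w - y can vanish only above x = 0. There y = w(0) = 1, so the
    place is Q, where the cofactor is a unit and the order is m0. *)
Lemma torsion_form_principal (O Q : place cst) (B : K) (w : {poly K}) :
    ~ (ord_ge O 0 x /\ ord_ge O 0 y) -> centered_at j Q 0 1 ->
    B != 0 -> size w = ell.+1 -> w.[0] = 1 -> F = - (B ^+ d *: 'X^m) + w ^+ d ->
  principal_mult O Q m.
Proof.
move=> O_inf Q01 B0 sw w0 EF.
have ab := centered_curve_eq M cstE hd Q01.
have OQ := centered_neq_infinity cstE O_inf Q01.
pose h := j (w%:P - 'X); pose U := norm_cofactor w.
have h0 : h != 0 by rewrite (model_neq0 M) ?y_form_size ?y_form_neq0.
have EN : h * j U = cst (B ^+ d) * x ^+ m.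
  rewrite norm_cofactorP {1}EF opprD addrA addrAC subrr add0r opprK.
  by rewrite -mul_polyC (polyCM (B ^+ d)%:P) (rmorphM j) -cstE polyC_exp (rmorphXn j).
have x0 : x != 0 by rewrite (model_C_neq0 M) // polyX_eq0.
have cB : cst (B ^+ d) != 0 by rewrite cstE (model_C_neq0 M) // polyC_eq0 expf_neq0.
have U_unit := pt_eval_norm_cofactor w0 (oner_neq0 K).
have jU : j U != 0 by apply: contraNneq U_unit => /(model_ev_ker M d_gt1 ab)/eqP.
have oQ : ord Q h = m.
  have oQU := ord_unit M cstE d_gt1 d_neq0 ab (smooth_at ab) Q01 U_unit.
  have := ord_xa M cstE d_gt1 d_neq0 ab (smooth_at ab) Q01.
  rewrite (negPf (oner_neq0 K)) polyC0 subr0 => oQx.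
  have := congr1 (ord Q) EN; rewrite !ordM ?(unit_expf_neq0 L_unit) // oQU addr0 => ->.
  by rewrite ord_cst ?expf_neq0 // (ordX L_unit) // oQx add0r; lia.
exists h => // R.
have [QR|QR] := eqVneq Q R; first by rewrite -QR [O == Q]eq_sym (negPf OQ) subr0.
have [OR|OR] := eqVneq O R; first by rewrite -OR infinity_ord_y_form // sub0r.
rewrite !mulr0n subr0; apply/eqP; apply: contraNT QR => oR.
have [Rx Ry] : ord_ge R 0 x /\ ord_ge R 0 y.
  apply/not_notP => R_inf; case/eqP: OR.
  exact: infinity_uniq M cstE d_gt1 cop _ _ O_inf R_inf.
apply/eqP; apply: (affine_place_uniq M cstE d_gt1 d_neq0 ab (smooth_at ab)) => //.
have Rp p : ord_ge R 0 (j p) by have := ord_ge_poly cstE p Rx Ry.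
have Rh : ord_ge R 1 h.
  by right; have := ord_geP h0 (Rp _); move: oR; rewrite -gtz0_ge1 lt0r => -> ->.
have Rx1 : ord_ge R 1 x.
  have /(ord_geP _) : ord_ge R (1 + 0) (h * j U) by apply: ord_geM.
  rewrite addr0 EN => /(_ _)/wrap[].
    by rewrite unit_mulf_neq0 // unit_expf_neq0.
  rewrite ordM ?unit_expf_neq0 // ord_cst ?expf_neq0 // add0r (ordX L_unit) //.
  move=> oxm; right; move: oxm; rewrite -!gtz0_ge1 => oxm.
  by rewrite ltNge; apply: contraTN oxm => le0; rewrite -leNgt mulrn_wle0.
apply: (centered_atP cstE); rewrite /value_at cstE; first by rewrite !rmorph0 subr0.
have [w1 Ew] : exists w1, w - 1 = w1 * 'X.
  have /factor_theorem[w1 Ew] : root (w - 1) 0 by rewrite /root !hornerE w0 subrr.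
  by exists w1; rewrite Ew polyC0 subr0.
(* y - 1 is (w - 1) - (w - y), and w - 1 is divisible by x. *)
have -> : y - j 1%:P%:P = j w1%:P * x - h.
  by rewrite /h (rmorphB j) -(rmorphM j) -polyCM -Ew !rmorphB /=; ring.
rewrite -[vanishes_at _ _]/(ord_ge R 1 (j w1%:P * x - h)).
apply: ord_geD; last exact: (ord_geN L_unit).
by rewrite -[1]add0r; apply: ord_geM.
Qed.

Lemma principal_m0_form (O P : place cst) a b :
    ~ (ord_ge O 0 x /\ ord_ge O 0 y) -> centered_at j P a b ->
    principal_mult O P m -> ~ principal_mult O P d ->
  b != 0 /\ exists v : {poly K}, [/\ size v = ell.+1, v.[a] = b &
    F = v ^+ d - lead_coef v ^+ d *: ('X - a%:P) ^+ m].
Proof.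
move=> O_inf Pab Pm Pd.
have ab := centered_curve_eq M cstE hd Pab.
have OP := centered_neq_infinity cstE O_inf Pab.
have b0 : b != 0.
  apply/eqP => b0; apply: Pd.
  exact: (ramified_principal M cstE hd hnd sF d_neq0 smooth O_inf Pab b0).
split=> //.
have [h [p [hp sp pm h0 oP]]] :=
  principal_mult_ord M cstE hd hnd sF d_neq0 smooth O_inf Pab Pm.
have ple i := polynomial_pole_le sF pm (i := i).
have [n_m m_nd] := m0_bounds hd hnd; have [_ d_n] := andP hd.
have ell_gt1 := ell0_gt1 hd hnd.
(* A nonconstant coefficient of y would give a pole of order at least n + d > m0. *)
have p1 : (size (p`_1)%R <= 1)%N.
  rewrite leqNgt; apply/negP => s1; have := ple 1%N d_gt1.
  rewrite -size_poly_gt0 (leq_trans _ s1) // => /(_ isT); rewrite leqNgt muln1.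
  move/negP; apply; apply: leq_trans m_nd _; rewrite addnC leq_add2r.
  by rewrite leq_pmulr // -subn1 subn_gt0.
have [c Ec] : exists c, p`_1 = c%:P by exists (p`_1)`_0; apply: size1_polyC.
have Ep : p = (p`_0)%:P + c%:P%:P * 'X.
  apply/polyP => -[|[|r]]; rewrite coefD coefC coefMX coefC /= ?addr0 ?add0r //.
  have [rd|dr] := ltnP r.+2 d; last by rewrite nth_default // (leq_trans sp).
  apply/eqP; apply: contraTT m_nd => /(ple _ rd) le_m; rewrite -leqNgt.
  apply: leq_trans (leq_trans _ (leq_addl _ _)) le_m.
  rewrite mulnC !mulSn addnA (leq_trans _ (leq_addr _ _)) // leq_add2l; exact: ltnW.
(* Otherwise the function is a polynomial in x of degree m0 / d with a root of multiplicity m0. *)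
have c0 : c != 0.
  apply/eqP => c0; rewrite c0 in Ep; rewrite !polyC0 mul0r addr0 in Ep.
  have [r [rd pr Er _]] := pm; have r0 : r = 0%N.
    by move: pr; rewrite Ep coefC; case: (r) => // r'; rewrite eqxx.
  rewrite r0 in pr Er; have := oP; rewrite hp Ep.
  have [s [G [_ -> lt_s]]] := ord_poly_x_root_mult M cstE hd hnd sF d_neq0 smooth Pab ab b0 pr.
  move=> [Es]; move: Er lt_s; rewrite /pole_weight muln0 addn0 Es.
  case: (size p`_0) => [|S] //= ES; rewrite ltnS {1}ES => dS.
  have S0 : S = 0%N by nia.
  by move: n_m; rewrite ES S0 muln0.
(* The pole order m0 differs from n, the weight of y, so it is attained by the term free of y. *)
have s0 : size p`_0 = ell.+1.
  have [r [rd pr Er _]] := pm.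
  have : r = 0%N \/ r = 1%N.
    case: r rd pr {Er} => [|[|r]] rd; [by left | by right |].
    by rewrite Ep coefD coefC coefMX coefC /= addr0 eqxx.
  case=> r01; rewrite r01 in pr Er.
    move: Er pr; rewrite /pole_weight muln0 addn0 /m0 => /eqP.
    rewrite eqn_pmul2l // => /eqP ->; rewrite -size_poly_gt0.
    by case: (size _).
  move: Er; rewrite /pole_weight muln1 sF /=.
  have -> : (size (p`_1)%R).-1 = 0%N by case: (size _) p1 => [|[]].
  by rewrite muln0 add0n => E; move: n_m; rewrite E ltnn.
pose v : {poly K} := - c^-1 *: p`_0.
have Nc0 : - c^-1 != 0 by rewrite oppr_eq0 invr_eq0.
have sv : size v = ell.+1 by rewrite size_scale.
have Nc1 : cst (- c^-1) != 0 by rewrite cstE (model_C_neq0 M) // polyC_eq0.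
have hv : cst (- c^-1) * h = j (v%:P - 'X).
  rewrite hp cstE -(rmorphM j) {1}Ep mulrDr -(polyCM _ p`_0).
  congr (j (_ + _)); first by rewrite mul_polyC.
  by rewrite mulrA -!polyCM mulNr mulVf // !polyCN polyC1 mulN1r.
have oPv : ord P (j (v%:P - 'X)) = m by rewrite -hv ordM // ord_cst // add0r.
have va : v.[a] = b.
  apply/eqP; apply: contraT => ne.
  have ev : pt_eval a b (v%:P - 'X) != 0
    by rewrite /pt_eval !(hornerD, hornerN, hornerC, hornerX) subr_eq0.
  have := ord_unit M cstE d_gt1 d_neq0 ab (smooth_at ab) Pab ev; rewrite oPv.
  by case=> m_0; rewrite m_0 in n_m.
exists v; split=> //.
have U_unit := pt_eval_norm_cofactor va b0.
have jU : j (norm_cofactor v) != 0.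
  by apply: contraNneq U_unit => /(model_ev_ker M d_gt1 ab)/eqP.
have jv : j (v%:P - 'X) != 0 by rewrite (model_neq0 M) ?y_form_size ?y_form_neq0.
have := congr1 (ord P) (norm_cofactorP v); rewrite ordM // oPv.
rewrite (ord_unit M cstE d_gt1 d_neq0 ab (smooth_at ab) Pab U_unit) addr0 => oN.
have N0 : v ^+ d - F != 0.
  apply/eqP => N0; have := unit_mulf_neq0 L_unit jv jU.
  by rewrite norm_cofactorP N0 !rmorph0 eqxx.
have v0 : v != 0 by rewrite -size_poly_eq0 sv.
have sN : size (v ^+ d) = m.+1.
  have := size_exp v d; rewrite sv /= mulnC -/m => <-.
  by rewrite prednK // size_poly_gt0 expf_neq0.
have sNF : size (v ^+ d - F) = m.+1.
  by rewrite size_polyDl ?size_polyN ?sN // sF ltnS.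
(* The norm has degree m0 and a root of multiplicity m0 at a, so the cofactor G is constant. *)
have [r [G [EN oN' _]]] := ord_poly_x_root_mult M cstE hd hnd sF d_neq0 smooth Pab ab b0 N0.
have {oN'}rm : r = m by move: oN; rewrite oN' => -[].
rewrite {r}rm in EN.
have G0 : G != 0 by apply: contraNneq N0 => G0; rewrite EN G0 mul0r.
have sG : (size G <= 1)%N.
  move: sNF; rewrite EN size_Mmonic ?monic_exp ?monicXsubC // size_exp_XsubC.
  by rewrite addnS /= -[X in _ = X]add1n => /addIn->.
have lG : lead_coef v ^+ d = lead_coef G.
  rewrite -lead_coef_exp -[LHS](@lead_coefDl _ _ (- F)) ?size_polyN ?sN ?sF ?ltnS //.
  by rewrite EN lead_coef_Mmonic // monic_exp // monicXsubC.
have -> : F = v ^+ d - (v ^+ d - F) by rewrite opprB addrCA subrr addr0.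
rewrite EN lG; congr (_ - _); rewrite -mul_polyC; congr (_ * _).
by rewrite (size1_polyC sG) lead_coefC.
Qed.

End TorsionForm.

(** * Descent to the subfield *)

Section PowerRoots.
Variables (k : fieldType) (d : nat).
Hypothesis d_neq0 : d%:R != 0 :> k.

Lemma exp_diff_factor (u v : {poly k}) (b : k) : u.[0] = b -> v.[0] = b -> b != 0 ->
  exists2 S : {poly k}, u ^+ d - v ^+ d = (u - v) * S & S.[0] != 0.
Proof.
move=> u0 v0 b0; exists (\sum_(i < d) u ^+ (d.-1 - i) * v ^+ i); first exact: subrXX.
rewrite horner_sum (eq_bigr (fun i : 'I_d => b ^+ (d.-1 - i) * b ^+ i)) => [|i _].
  by rewrite sum_expr_same -mulr_natl mulf_neq0 // expf_neq0.
by rewrite !hornerE u0 v0.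
Qed.

(** Hensel lifting: T^d - g has derivative d b^(d-1) at T = b, which is nonzero. *)
Lemma exp_root_ex (g : {poly k}) (b : k) N : b != 0 -> b ^+ d = g.[0] ->
  exists v : {poly k}, [/\ (size v <= N.+1)%N, v.[0] = b & 'X^(N.+1) %| v ^+ d - g].
Proof.
move=> b0 bg; elim: N => [|N [v [sv v0 /dvdpP[r Er]]]].
  exists b%:P; rewrite size_polyC b0 hornerC; split=> //.
  by rewrite expr1 -['X]subr0 -polyC0 dvdp_XsubCl /root !hornerE bg subrr.
pose D := b ^+ d.-1 *+ d.
have D0 : D != 0 by rewrite /D -mulr_natl mulf_neq0 // expf_neq0.
(* Adding c X^(N+1) changes the coefficient of X^(N+1) in v^d - g from r(0) to r(0) + c D, which
   this c cancels. *)
pose c := - r.[0] / D; pose v' := v + c *: 'X^(N.+1).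
have v'0 : v'.[0] = b by rewrite hornerD hornerZ hornerXn expr0n mulr0 addr0.
pose S := \sum_(i < d) v' ^+ (d.-1 - i) * v ^+ i.
have S0 : S.[0] = D.
  rewrite horner_sum (eq_bigr (fun i : 'I_d => b ^+ (d.-1 - i) * b ^+ i)) => [|i _].
    by rewrite sum_expr_same.
  by rewrite hornerM !horner_exp v'0 v0.
exists v'; split=> //.
  rewrite (leq_trans (size_polyD _ _)) // geq_max (leq_trans sv) //=.
  by rewrite (leq_trans (size_scale_leq _ _)) // size_polyXn.
have -> : v' ^+ d - g = 'X^(N.+1) * (c *: S + r).
  have -> : v' ^+ d - g = (v' ^+ d - v ^+ d) + (v ^+ d - g) by rewrite addrA subrK.
  rewrite subrXX Er -/S {1}/v' addrAC subrr add0r.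
  by rewrite mulrDr -scalerAl scalerAr [r * _]mulrC.
rewrite exprSr dvdp_mul // -['X]subr0 -polyC0 dvdp_XsubCl /root !hornerE S0.
by rewrite /c divfK // addNr.
Qed.

(** The cofactor of u - v is prime to X, so X^N divides u - v, whose degree is less than N. *)
Lemma exp_root_uniq (u v : {poly k}) (b : k) N : b != 0 -> u.[0] = b -> v.[0] = b ->
    (size u <= N)%N -> (size v <= N)%N -> 'X^N %| u ^+ d - v ^+ d ->
  u = v.
Proof.
move=> b0 u0 v0 su sv; have [S -> S0] := exp_diff_factor u0 v0 b0.
rewrite Gauss_dvdpl; last by rewrite coprimep_expl // coprimep_sym coprimepX.
move=> dv; apply/eqP; rewrite -subr_eq0; apply: contraTT dv => uv0.
apply: contraTN isT => /dvdp_leq -/(_ uv0); rewrite size_polyXn ltnNge.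
by rewrite (leq_trans (size_polyD _ _)) // geq_max su size_polyN.
Qed.

End PowerRoots.

(** With q = w - B X^ell, the polynomial w^d - (B X^ell)^d is q S. The d terms of S have degree ell
    (d - 1) and leading coefficient B^(d-1), and these add up to d B^(d-1), which is nonzero. So deg
    q = n - ell (d - 1) = n + ell - m0. *)
Lemma torsion_form_intro (k : fieldType) n d (ft w : {poly k}) :
    (2 <= d < n)%N -> coprime n d -> d%:R != 0 :> k -> size ft = n.+1 ->
    size w = (ell0 n d).+1 -> w.[0] = 1 ->
    ft = - (lead_coef w ^+ d *: 'X^(m0 n d)) + w ^+ d ->
  torsion_form n d ft.
Proof.
move=> hd hnd d0 sft sw w0 Eft; set B := lead_coef w; set ell := ell0 n d.
have w_neq0 : w != 0 by rewrite -size_poly_eq0 sw.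
have B0 : B != 0 by rewrite lead_coef_eq0.
have ell_gt1 : (1 < ell)%N := ell0_gt1 hd hnd.
have d_gt1 : (1 < d)%N by case/andP: hd.
exists B, w; split=> //; exists (w - B *: 'X^ell).
set q := w - _; pose u := B *: 'X^ell.
pose S := \sum_(i < d) w ^+ (d.-1 - i) * u ^+ i.
have Eq : ft = q * S.
  rewrite Eft addrC {1}/m0 -/ell mulnC exprM -exprZn; exact: subrXX.
have ft0 : ft != 0 by rewrite -size_poly_eq0 sft.
have [q0 S0] : q != 0 /\ S != 0 by move: ft0; rewrite Eq mulf_eq0 negb_or => /andP[].
have su : size u = ell.+1 by rewrite size_scale // size_polyXn.
have lu : lead_coef u = B by rewrite lead_coefZ lead_coefXn mulr1.
have u0 : u != 0 by rewrite -size_poly_eq0 su.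
have term (i : 'I_d) : size (w ^+ (d.-1 - i) * u ^+ i) = (ell * d.-1).+1 /\
    lead_coef (w ^+ (d.-1 - i) * u ^+ i) = B ^+ d.-1.
  have lt_id := ltn_ord i.
  split; last first.
    by rewrite lead_coefM !lead_coef_exp lu -exprD subnK // -ltnS prednK // ltnW.
  have E0 := size_exp w (d.-1 - i); have E1 := size_exp u i.
  have w1 : w ^+ (d.-1 - i) != 0 by rewrite expf_neq0.
  have u1 : u ^+ i != 0 by rewrite expf_neq0.
  rewrite size_mul //; move: w1 u1 E0 E1; rewrite -!size_poly_gt0 sw su /=.
  case: (size _) => // s1 _; case: (size _) => // s2 _ /= -> ->.
  by rewrite addnS /= -mulnDr subnK // -ltnS prednK // ltnW.
have sS : size S = (ell * d.-1).+1.
  apply/eqP; rewrite eqn_leq; apply/andP; split.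
    apply: leq_trans (size_sum _ _ _) _; apply/bigmax_leqP => i _.
    by have [-> _] := term i.
  rewrite ltnNge; apply/negP => /leq_sizeP/(_ _ (leqnn _)) /eqP.
  rewrite coef_sum (eq_bigr (fun=> B ^+ d.-1)) => [|i _].
    by rewrite sumr_const card_ord -mulr_natl mulf_eq0 (negPf d0) expf_eq0 (negPf B0) andbF.
  by have [si <-] := term i; rewrite lead_coefE si.
split=> //; last by rewrite addrC subrK.
  have := congr1 (fun p : {poly k} => size p) Eq; rewrite sft size_mul // sS addnS /=.
  rewrite /m0 -/ell => E.
  have sq : (0 < size q)%N by rewrite size_poly_gt0.
  have Em : (d * ell = ell + ell * d.-1)%N.
    by rewrite -mulnS mulnC prednK // ltnW.
  rewrite Em (addnC n) subnDl; move: sq E; case: (size q) => // s _.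
  by rewrite addSn => -[->]; rewrite addnK.
by rewrite /q hornerD hornerN hornerZ hornerXn expr0n (gtn_eqF (ltnW ell_gt1)) mulr0 subr0.
Qed.

Lemma size_comp_XaddC (k : fieldType) (p : {poly k}) a : size (p \Po ('X + a%:P)) = size p.
Proof. by rewrite size_comp_poly2 // size_XaddC. Qed.

Lemma lead_coef_comp_XaddC (k : fieldType) (p : {poly k}) a :
  lead_coef (p \Po ('X + a%:P)) = lead_coef p.
Proof. by rewrite lead_coef_comp ?size_XaddC // lead_coefXaddC expr1n mulr1. Qed.

(* The root v of f modulo ('X - a) ^+ m0 n d with the value b at a is unique, *)
(* so it is defined over the field of definition of f, a and b.              *)
Lemma torsion_form_descent (k0 k : fieldType) (iota : {rmorphism k0 -> k}) n d
    (f : {poly k0}) (a b : k0) (v : {poly k}) :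
    (2 <= d < n)%N -> coprime n d -> d%:R != 0 :> k0 -> size f = n.+1 ->
    b != 0 -> b ^+ d = f.[a] -> size v = (ell0 n d).+1 -> v.[iota a] = iota b ->
    map_poly iota f = v ^+ d - lead_coef v ^+ d *: ('X - (iota a)%:P) ^+ m0 n d ->
  torsion_form n d ((b ^+ d)^-1 *: (f \Po ('X + a%:P))).
Proof.
move=> hd hnd d0 sf b0 ba sv va Ef.
have d_gt1 : (1 < d)%N by case/andP: hd.
have [n_m _] := m0_bounds hd hnd.
have ell_gt1 := ell0_gt1 hd hnd.
have ell_m : (ell0 n d < m0 n d)%N by rewrite /m0 ltn_Pmull // ltnW.
set m := m0 n d in Ef n_m ell_m *.
pose g := f \Po ('X + a%:P); pose V := v \Po ('X + (iota a)%:P).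
have g0 : b ^+ d = g.[0] by rewrite horner_comp !hornerE ?add0r.
have V0 : V.[0] = iota b by rewrite horner_comp !hornerE ?add0r.
have sV : size V = (ell0 n d).+1 by rewrite size_comp_XaddC.
have Eg : map_poly iota g = V ^+ d - lead_coef V ^+ d *: 'X^m.
  rewrite map_comp_poly rmorphD /= map_polyX map_polyC /= Ef lead_coef_comp_XaddC.
  rewrite rmorphB /= linearZ /= !rmorphXn /= comp_polyB comp_polyX comp_polyC.
  by rewrite addrK.
have [u [su u0 du]] := exp_root_ex d0 m.-1 b0 g0.
rewrite prednK ?(leq_ltn_trans _ n_m) // in su du.
have dk : d%:R != 0 :> k by rewrite -(rmorph_nat iota) fmorph_eq0.
(* Both sides are d-th roots of g modulo X^m with the same value at 0 and size at most m. *)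
have EV : V = map_poly iota u.
  apply: (exp_root_uniq dk (b := iota b) (N := m)) => //.
  - by rewrite fmorph_eq0.
  - by rewrite -u0 -(rmorph0 iota) horner_map.
  - by rewrite sV.
  - by rewrite size_map_poly.
  have -> : V ^+ d - map_poly iota u ^+ d =
      lead_coef V ^+ d *: 'X^m - map_poly iota (u ^+ d - g).
    rewrite rmorphB /= Eg rmorphXn /=.
    by move: (V ^+ d) (map_poly iota u ^+ d) (_ *: _) => A B C; ring.
  apply: dvdp_sub; first by rewrite -mul_polyC dvdp_mull.
  by rewrite -(map_polyXn iota) dvdp_map.
have Egu : g = u ^+ d - lead_coef u ^+ d *: 'X^m.
  apply: (map_poly_inj iota); rewrite Eg EV lead_coef_map.
  by rewrite rmorphB /= map_polyZ /= map_polyXn !rmorphXn.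
pose w := b^-1 *: u.
have bV0 : b^-1 != 0 by rewrite invr_eq0.
have lw : lead_coef w = b^-1 * lead_coef u by rewrite lead_coefZ.
apply: (torsion_form_intro (w := w)) => //.
- by rewrite size_scale ?invr_eq0 ?expf_neq0 // size_comp_XaddC.
- by rewrite size_scale // -sV EV size_map_poly.
- by rewrite hornerZ u0 mulVf.
rewrite -/g Egu lw exprZn exprMn exprVn scalerBr scalerA [RHS]addrC.
by [].
Qed.

(** * Isomorphisms of curves *)

Section FractionLift.
Variables (A : comNzRingType) (L1 L2 : comUnitRingType).
Variables (j1 : {rmorphism A -> L1}) (j2 : {rmorphism A -> L2}).
Hypotheses (L1_unit : forall g : L1, g != 0 -> g \is a GRing.unit)
           (L2_unit : forall g : L2, g != 0 -> g \is a GRing.unit).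
Hypothesis j_ker : forall p, j1 p = 0 <-> j2 p = 0.
Hypothesis j2_frac : forall h : L2, exists p q, j2 q != 0 /\ h * j2 q = j2 p.

Let frac_pair (h : L2) : {pq : A * A | j2 pq.2 != 0 /\ h * j2 pq.2 = j2 pq.1}.
Proof. by apply: cid; have [p [q H]] := j2_frac h; exists (p, q). Qed.

(** The universal property of fractions; equality of the kernels of [j1] and [j2] makes the result
    independent of the chosen representation. *)
Definition fraction_lift (h : L2) : L1 :=
  j1 (sval (frac_pair h)).1 / j1 (sval (frac_pair h)).2.

Let j1_unit q : j2 q != 0 -> j1 q \is a GRing.unit.
Proof. by move=> jq; apply: L1_unit; apply: contraNneq jq => /j_ker->. Qed.

Lemma fraction_liftE h p q : j2 q != 0 -> h * j2 q = j2 p ->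
  fraction_lift h * j1 q = j1 p.
Proof.
rewrite /fraction_lift; case: (frac_pair h) => -[p' q'] /= [q'0 E'] q0 E.
apply: (mulIr (j1_unit q'0)); rewrite mulrAC divrK ?j1_unit // -!rmorphM.
apply/eqP; rewrite -subr_eq0 -rmorphB; apply/eqP/j_ker.
by rewrite rmorphB !rmorphM /= -E -E'; ring.
Qed.

Fact fraction_lift_is_zmod_morphism : zmod_morphism fraction_lift.
Proof.
move=> g h; have [p [q [q0 Eg]]] := j2_frac g; have [p' [q' [q'0 Eh]]] := j2_frac h.
have qq0 : j2 (q * q') != 0 by rewrite rmorphM unit_mulf_neq0.
have Egh : (g - h) * j2 (q * q') = j2 (p * q' - p' * q).
  by rewrite rmorphB !rmorphM /= -Eg -Eh; ring.
apply: (mulIr (j1_unit qq0)); rewrite (fraction_liftE qq0 Egh).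
rewrite rmorphB !rmorphM /= -(fraction_liftE q0 Eg) -(fraction_liftE q'0 Eh).
by ring.
Qed.

Fact fraction_lift_is_monoid_morphism : monoid_morphism fraction_lift.
Proof.
split=> [|g h].
  have j10 : j2 1 != 0 by rewrite rmorph1 oner_neq0.
  have := @fraction_liftE 1 1 1 j10 (mul1r _).
  by rewrite rmorph1 mulr1.
have [p [q [q0 Eg]]] := j2_frac g; have [p' [q' [q'0 Eh]]] := j2_frac h.
have qq0 : j2 (q * q') != 0 by rewrite rmorphM unit_mulf_neq0.
have Egh : g * h * j2 (q * q') = j2 (p * p').
  by rewrite !rmorphM /= -Eg -Eh; ring.
apply: (mulIr (j1_unit qq0)); rewrite (fraction_liftE qq0 Egh).
rewrite !rmorphM /= -(fraction_liftE q0 Eg) -(fraction_liftE q'0 Eh).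
by ring.
Qed.

HB.instance Definition _ := GRing.isZmodMorphism.Build L2 L1 fraction_lift
  fraction_lift_is_zmod_morphism.
HB.instance Definition _ := GRing.isMonoidMorphism.Build L2 L1 fraction_lift
  fraction_lift_is_monoid_morphism.

Lemma fraction_lift_poly p : fraction_lift (j2 p) = j1 p.
Proof.
have j10 : j2 1 != 0 by rewrite rmorph1 oner_neq0.
have := @fraction_liftE (j2 p) p 1 j10; rewrite !rmorph1 !mulr1; exact.
Qed.

Lemma fraction_lift_inj : injective fraction_lift.
Proof.
move=> g h /eqP; rewrite -subr_eq0 -(rmorphB fraction_lift) => /eqP E.
apply/eqP; rewrite -subr_eq0; apply: contraT => /L2_unit u.
have := oner_neq0 L1.
by rewrite -(rmorph1 fraction_lift) -(divrr u) (rmorphM fraction_lift) /= E mul0r eqxx.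
Qed.

Lemma fraction_lift_bij :
  (forall h : L1, exists p q, j1 q != 0 /\ h * j1 q = j1 p) -> bijective fraction_lift.
Proof.
move=> j1_frac.
have ex h : exists g, fraction_lift g = h.
  have [p [q [q0 E]]] := j1_frac h.
  have jq : j2 q != 0 by apply: contraNneq q0 => /j_ker->.
  exists (j2 p / j2 q); apply: (mulIr (j1_unit jq)); rewrite E.
  by apply: fraction_liftE => //; rewrite divrK // L2_unit.
exists (fun h => projT1 (cid (ex h))) => [g|h]; last by case: cid.
by apply: fraction_lift_inj; case: cid.
Qed.

Lemma fraction_lift_ex : exists phi : {rmorphism L2 -> L1},
  (forall p, phi (j2 p) = j1 p) /\
  ((forall h : L1, exists p q, j1 q != 0 /\ h * j1 q = j1 p) -> bijective phi).
Proof.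
by exists fraction_lift; split; [apply: fraction_lift_poly | apply: fraction_lift_bij].
Qed.

End FractionLift.

Lemma bij_rmorph_inverse (R S : nzRingType) (phi : {rmorphism R -> S}) :
  bijective phi -> exists psi : {rmorphism S -> R}, cancel phi psi /\ cancel psi phi.
Proof.
case=> psi phiK psiK.
pose A := GRing.isZmodMorphism.Build S R psi (can2_zmod_morphism phiK psiK).
pose B := GRing.isMonoidMorphism.Build S R psi (can2_monoid_morphism phiK psiK).
pose psiR : {rmorphism S -> R} := HB.pack psi A B.
by exists psiR.
Qed.

Lemma curve_model (k : fieldType) (d : nat) (F : {poly k}) :
  (1 < d)%N -> coprime (size F).-1 d -> affine_model d F (fun_of_poly d F).
Proof.
move=> d_gt1 cop; split.
- by move=> g; rewrite funfield_unitE // ltnW.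
- by move=> p sp /eqP; rewrite fun_of_poly_eq0 // => /eqP.
- exact: fun_of_poly_curve.
- exact: fun_of_poly_frac.
Qed.

Section AffineSubst.
Variables (k : fieldType).

(* x -> x + a and y -> c y. *)
Definition affine_subst (a c : k) :
    {rmorphism {poly {poly k}} -> {poly {poly k}}} :=
  comp_poly (c%:P%:P * 'X) \o map_poly (comp_poly ('X + a%:P)).

Arguments affine_subst : simpl never.

Lemma affine_substX a c : affine_subst a c 'X = c%:P%:P * 'X.
Proof. by rewrite /affine_subst /= map_polyX comp_polyX. Qed.

Lemma affine_substC a c q : affine_subst a c q%:P = (q \Po ('X + a%:P))%:P.
Proof. by rewrite /affine_subst /= map_polyC comp_polyC. Qed.

Lemma affine_substK a b c d (p : {poly {poly k}}) : a + b = 0 -> c * d = 1 ->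
  affine_subst a c (affine_subst b d p) = p.
Proof.
move=> ab cd; elim/poly_ind: p => [|p q IHp]; first by rewrite !rmorph0.
rewrite !(rmorphD (affine_subst _ _)) !(rmorphM (affine_subst _ _)) IHp.
rewrite !affine_substX (rmorphM (affine_subst _ _)) affine_substX !affine_substC.
rewrite comp_polyC !mulrA -(mulrA p) -!polyCM [d * c]mulrC cd mulr1 -comp_polyA.
rewrite comp_polyD comp_polyX comp_polyC -addrA -polyCD ab addr0 comp_polyXr.
by [].
Qed.

End AffineSubst.

Lemma map_affine_subst (k0 k : fieldType) (iota : {rmorphism k0 -> k}) a c p :
  map_poly (map_poly iota) (affine_subst a c p) =
  affine_subst (iota a) (iota c) (map_poly (map_poly iota) p).
Proof.
elim/poly_ind: p => [|p q IHp]; first by rewrite !rmorph0.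
rewrite (rmorphD (affine_subst a c)) (rmorphM (affine_subst a c)).
rewrite !(rmorphD (map_poly (map_poly iota))) !(rmorphM (map_poly (map_poly iota))).
rewrite (rmorphD (affine_subst _ _)) (rmorphM (affine_subst _ _)).
congr (_ * _ + _); first exact: IHp.
  rewrite affine_substX (rmorphM (map_poly (map_poly iota))) /= !map_polyX.
  by rewrite comp_polyX !map_polyC /= ?map_polyC.
rewrite affine_substC /= !map_polyC /= comp_polyC.
by rewrite map_comp_poly rmorphD /= map_polyX map_polyC.
Qed.

Section Transport.
Variables (K : closedFieldType) (L1 L2 : comUnitRingType).
Variables (cst1 : K -> L1) (cst2 : K -> L2) (phi : {rmorphism L2 -> L1}).
Hypotheses (phi_bij : bijective phi) (phi_cst : forall c, phi (cst2 c) = cst1 c).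

Local Notation push := (pullback_place phi_bij phi_cst).

Lemma push_bij : bijective push.
Proof.
have [psi [phiK psiK]] := bij_rmorph_inverse phi_bij.
have psi_bij : bijective psi by exists phi.
have psi_cst c : psi (cst1 c) = cst2 c by rewrite -phi_cst phiK.
exists (pullback_place psi_bij psi_cst) => R; apply: place_eq => h _ /=.
  by rewrite psiK.
by rewrite phiK.
Qed.

Lemma vanishes_at_push (R : place cst1) h : vanishes_at (push R) h <-> vanishes_at R (phi h).
Proof.
split=> -[H|]; [left | by right | left | by right]; first by rewrite H rmorph0.
by apply: (bij_inj phi_bij); rewrite H rmorph0.
Qed.

Lemma regular_at_push (R : place cst1) h : regular_at (push R) h <-> regular_at R (phi h).
Proof.
split=> -[H|]; [left | by right | left | by right]; first by rewrite H rmorph0.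
by apply: (bij_inj phi_bij); rewrite H rmorph0.
Qed.

Lemma value_at_push (R : place cst1) h c : value_at (push R) h c <-> value_at R (phi h) c.
Proof. by rewrite /value_at vanishes_at_push rmorphB phi_cst. Qed.

(** The map on places is bijective and compatible with orders, so divisors correspond. *)
Lemma principal_mult_push (O P : place cst1) i :
  principal_mult (push O) (push P) i <-> principal_mult O P i.
Proof.
have inj_push := bij_inj push_bij.
split=> -[h h0 hD].
  exists (phi h); first exact: phi_neq0 phi_bij h h0.
  by move=> R; have := hD (push R); rewrite !(inj_eq inj_push).
have [psi [phiK psiK]] := bij_rmorph_inverse phi_bij.
exists (psi h) => [|R'].
  by apply: contra_neq h0 => ph0; rewrite -(psiK h) ph0 rmorph0.
have [push' _ pushK] := push_bij; rewrite -(pushK R').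
by rewrite !(inj_eq inj_push) -hD /= psiK.
Qed.

End Transport.

Section Translation.
Variables (k : fieldType) (d : nat) (F : {poly k}) (a b : k).
Variables (L1 L2 : comUnitRingType).
Variables (j1 : {rmorphism {poly {poly k}} -> L1}).
Variables (j2 : {rmorphism {poly {poly k}} -> L2}).
Hypotheses (d_gt1 : (1 < d)%N) (b_neq0 : b != 0).

Local Notation G := ((b ^+ d)^-1 *: (F \Po ('X + a%:P))).

Hypotheses (M1 : affine_model d F j1) (M2 : affine_model d G j2).

Local Notation s := (affine_subst (- a) b^-1).
Local Notation s' := (affine_subst a b).

Let sK p : s' (s p) = p.
Proof. by apply: affine_substK; rewrite ?subrr ?divff. Qed.

Let s'K p : s (s' p) = p.
Proof. by apply: affine_substK; rewrite ?addNr ?mulVf. Qed.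

Let c := b ^+ d.
Let cVK : (c^-1)%:P%:P * c%:P%:P = 1 :> {poly {poly k}}.
Proof. by rewrite -!polyCM mulVf ?expf_neq0. Qed.

(** The two curve equations correspond up to a constant, which is why [js] and [j2] have the same
    kernel. *)
Let s_curve : s ('X^d - G%:P) = (c^-1)%:P%:P * ('X^d - F%:P).
Proof.
rewrite (rmorphB s) (rmorphXn s) affine_substX affine_substC mulrBr.
congr (_ - _).
  by rewrite exprMn -(polyC_exp d (b^-1)%:P) -(polyC_exp d b^-1) exprVn.
rewrite -(polyCM (c^-1)%:P); congr (_%:P).
rewrite comp_polyZ -comp_polyA comp_polyD comp_polyX comp_polyC.
by rewrite -addrA -polyCD addNr addr0 comp_polyXr mul_polyC.
Qed.

Let js : {rmorphism {poly {poly k}} -> L1} := j1 \o s.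

Let jsE p : js p = j1 (s p). Proof. by []. Qed.

Let js_ker p : js p = 0 <-> j2 p = 0.
Proof.
rewrite jsE; split=> [/(model_ker M1 d_gt1)[q Eq]|/(model_ker M2 d_gt1)[q ->]].
  have -> : p = s' (q * c%:P%:P) * ('X^d - G%:P).
    rewrite -[LHS]sK Eq -['X^d - G%:P]sK -(rmorphM s') s_curve; congr (s' _).
    by rewrite mulrA -(mulrA q) [c%:P%:P * _]mulrC cVK mulr1.
  by rewrite (rmorphM j2) (model_curve M2) mulr0.
by rewrite (rmorphM s) s_curve !(rmorphM j1) (model_curve M1) !mulr0.
Qed.

Lemma translation_iso : exists phi : {rmorphism L2 -> L1},
  bijective phi /\ forall p, phi (j2 p) = j1 (s p).
Proof.
have [phi [phi_j phi_bij]] :=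
  fraction_lift_ex (model_unit M1) (model_unit M2) js_ker (model_quotient M2 d_gt1).
exists phi; split; last exact: phi_j.
apply: phi_bij => h; have [p [q [q0 E]]] := model_quotient M1 d_gt1 h.
by exists (s' p), (s' q); rewrite !jsE !s'K.
Qed.

End Translation.

Lemma rmorph_quotient (R S : nzRingType) (phi : {rmorphism R -> S}) (h u v : R) u' v' :
    injective phi -> phi u = u' -> phi v = v' ->
  (u != 0 /\ h * u = v) <-> (u' != 0 /\ phi h * u' = v').
Proof.
move=> phi_inj <- <-; rewrite -(inj_eq phi_inj) rmorph0 -rmorphM.
by split=> -[u0 E]; split=> //; [rewrite E | apply: phi_inj].
Qed.

(** The comorphism is x -> x - a, y -> y / b, taking the point (a, b) to (0, 1). This substitution
    and its inverse have coefficients in k0, so the function fields over k0 correspond. *)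
Lemma curve_iso_translation (k0 k : fieldType) (iota : {rmorphism k0 -> k}) (d : nat)
    (f : {poly k0}) (a b : k0) :
    (1 < d)%N -> coprime (size f).-1 d -> b != 0 ->
  let F := map_poly iota f in
  let g := (b ^+ d)^-1 *: (f \Po ('X + a%:P)) in
  let G := map_poly iota g in
  exists phi : curve_iso iota d f g,
    comorph phi (fun_of_poly d G 'X%:P) = fun_of_poly d F ('X - (iota a)%:P)%:P /\
    comorph phi (fun_of_poly d G 'X) = fun_of_poly d F ((iota b)^-1%:P%:P * 'X).
Proof.
move=> d_gt1 cop b0 F g G.
have ib0 : iota b != 0 by rewrite fmorph_eq0.
have EG : G = (iota b ^+ d)^-1 *: (F \Po ('X + (iota a)%:P)).
  rewrite /G map_polyZ /= map_comp_poly rmorphD /= map_polyX map_polyC /=.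
  by rewrite fmorphV rmorphXn.
have sg : size g = size f.
  by rewrite size_scale ?invr_eq0 ?expf_neq0 // size_comp_XaddC.
have M1 : affine_model d F (fun_of_poly d F) by apply: curve_model; rewrite ?size_map_poly.
have M2 : affine_model d ((iota b ^+ d)^-1 *: (F \Po ('X + (iota a)%:P))) (fun_of_poly d G).
  by rewrite -EG; apply: curve_model; rewrite ?size_map_poly ?sg.
have [phi [phi_bij phi_j]] := translation_iso d_gt1 ib0 M1 M2.
pose s := affine_subst (- a) b^-1; pose s' := affine_subst a b.
pose Mp := map_poly (map_poly iota).
have MpE p : Mp (s p) = affine_subst (- iota a) (iota b)^-1 (Mp p).
  by rewrite /Mp map_affine_subst (rmorphN iota) (fmorphV iota).
have phi_M p : phi (fun_of_poly d G (Mp p)) = fun_of_poly d F (Mp (s p)).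
  by rewrite MpE; exact: phi_j.
have sK p : s (s' p) = p by apply: affine_substK; rewrite ?addNr ?mulVf.
have phi_inj := bij_inj phi_bij.
have phi_cst c : phi (fun_cst d G c) = fun_cst d F c.
  rewrite -[RHS]/(fun_of_poly d F c%:P%:P) -(comp_polyC c ('X - (iota a)%:P)).
  rewrite -polyCN -(affine_substC _ (iota b)^-1); exact: phi_j.
have phi_over h : fun_over (phi h) <-> fun_over h.
  split=> -[p [q [q0 E]]].
    have Eq : phi (subfun_of_poly iota d g (s' q)) = subfun_of_poly iota d f q.
      by rewrite -[in RHS](sK q); exact: phi_M.
    have Ep : phi (subfun_of_poly iota d g (s' p)) = subfun_of_poly iota d f p.
      by rewrite -[in RHS](sK p); exact: phi_M.
    by exists (s' p), (s' q); apply/(rmorph_quotient h phi_inj Eq Ep).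
  have Eq : phi (subfun_of_poly iota d g q) = subfun_of_poly iota d f (s q) by exact: phi_M.
  have Ep : phi (subfun_of_poly iota d g p) = subfun_of_poly iota d f (s p) by exact: phi_M.
  by exists (s p), (s q); apply/(rmorph_quotient h phi_inj Eq Ep).
exists (CurveIso phi_bij phi_cst phi_over); split.
  have -> : ('X - (iota a)%:P)%:P = affine_subst (- iota a) (iota b)^-1 'X%:P.
    by rewrite affine_substC comp_polyX polyCN.
  exact: phi_j.
by rewrite -(affine_substX (- iota a)); exact: phi_j.
Qed.

(** * Points of order m0 *)

Lemma has_order_principal (K : closedFieldType) (L : comUnitRingType) (cst : K -> L)
    (O P : place cst) m : (forall g : L, g != 0 -> g \is a GRing.unit) ->
  has_order (abel_jacobi O P) m <->
  [/\ (0 < m)%N, principal_mult O P m &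
      forall i, (0 < i < m)%N -> ~ principal_mult O P i].
Proof.
move=> L_unit; have ajP := abel_jacobi_mulrn_eq0 L_unit O P.
split=> -[m_gt0 Pm min_m]; split=> //.
- exact/ajP.
- by move=> i im /ajP/eqP; apply/negP; apply: min_m.
- exact/ajP.
by move=> i im; apply/eqP => /ajP; apply: min_m.
Qed.

Lemma natr_neq0_pchar (R : fieldType) d : (0 < d)%N ->
  (forall p : nat, p \in [pchar R] -> ~~ (p %| d)%N) -> d%:R != 0 :> R.
Proof.
move=> d_gt0 hchar; apply/negP => d0; have [p pR] := natf0_pchar d_gt0 d0.
by have := hchar p pR; rewrite (dvdn_pcharf pR) d0.
Qed.

Section TorsionOrder.
Variables (K : closedFieldType) (n d : nat) (F : {poly K}) (L : comUnitRingType).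
Variables (j : {rmorphism {poly {poly K}} -> L}) (cst : K -> L).
Hypotheses (M : affine_model d F j) (cstE : forall c, cst c = j c%:P%:P).
Hypotheses (hd : (2 <= d < n)%N) (hnd : coprime n d) (sF : size F = n.+1).
Hypothesis d_neq0 : d%:R != 0 :> K.
Hypothesis smooth : forall a, F.[a] = 0 -> F^`().[a] != 0.

(* If i < m0 n d is at least n then the multiple m0 n d - i is less than n. *)
Lemma torsion_form_order (O Q : place cst) (B : K) (w : {poly K}) :
    ~ (ord_ge O 0 (j 'X%:P) /\ ord_ge O 0 (j 'X)) -> centered_at j Q 0 1 ->
    B != 0 -> size w = (ell0 n d).+1 -> w.[0] = 1 ->
    F = - (B ^+ d *: 'X^(m0 n d)) + w ^+ d ->
  has_order (abel_jacobi O Q) (m0 n d).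
Proof.
move=> O_inf Q01 B0 sw w0 EF; have L_unit := model_unit M.
have [n_m m_nd] := m0_bounds hd hnd; have [_ d_n] := andP hd.
have Pm := torsion_form_principal M cstE hd hnd sF d_neq0 smooth O_inf Q01 B0 sw w0 EF.
have ajP := abel_jacobi_mulrn_eq0 L_unit O Q.
have small i := small_mult_not_principal M cstE hd hnd sF d_neq0 smooth O_inf Q01
  (i := i) (oner_neq0 K).
apply/(has_order_principal O Q _ L_unit); split=> //; first exact: leq_ltn_trans n_m.
move=> i /andP[i_gt0 i_m]; have [i_n|n_i] := ltnP i n; first by apply: small; rewrite i_gt0.
move=> Pi; apply: (small (m0 n d - i)%N).
  rewrite subn_gt0 i_m /= ltn_subLR; last exact: ltnW.
  by apply: leq_trans m_nd _; rewrite leq_add // ltnW.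
by apply/ajP; rewrite mulrnBr ?(ltnW i_m) // ((ajP _).2 Pm) ((ajP _).2 Pi) subrr.
Qed.

End TorsionOrder.

Section SubfieldCurve.
Variables (K : closedFieldType) (n d : nat).
Hypotheses (hd : (2 <= d < n)%N) (hnd : coprime n d) (d_neq0 : d%:R != 0 :> K).
Variables (K0 : fieldType) (iota : {rmorphism K0 -> K}) (f : {poly K0}).
Hypotheses (sf : size f = n.+1) (sepf : separable_poly f).

Local Notation F := (map_poly iota f).
Local Notation j := (fun_of_poly d F).

Let d_gt1 : (1 < d)%N. Proof. by case/andP: hd. Qed.

Lemma subfield_size : size F = n.+1.
Proof. by rewrite size_map_poly. Qed.

Lemma subfield_model : affine_model d F j.
Proof. by apply: curve_model; rewrite ?subfield_size. Qed.

Lemma subfield_smooth a : F.[a] = 0 -> F^`().[a] != 0.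
Proof.
have : separable_poly F by rewrite separable_map.
by rewrite unlock => /coprimep_root H /rootP /H.
Qed.

Let J : {rmorphism {poly {poly K}} -> funfield d F} := j.

Let J_cst c : fun_cst d F c = J c%:P%:P.
Proof. by []. Qed.

Lemma affine_point_centered (P : point d F) a b :
  is_affine_point P a b -> centered_at J P a b.
Proof.
case=> Pa Pb.
exact: (@centered_atP K (funfield d F) J (fun_cst d F) J_cst P a b Pa Pb).
Qed.

(** x and y belong to the function field over K0, so rationality applies to them directly. *)
Lemma rational_affine_point (P : point d F) :
  rational_point P -> ~ at_infinity P ->
  exists a b : K0, is_affine_point P (iota a) (iota b).
Proof.
move=> Prat Paff.
have [Px Py] : regular_at P (fun_x d F) /\ regular_at P (fun_y d F) by apply/not_notP.
have E1 : subfun_of_poly iota d f 1 = 1.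
  by rewrite /subfun_of_poly rmorph1; exact: (rmorph1 J).
have over (p : {poly {poly K0}}) : fun_over (subfun_of_poly iota d f p).
  by exists p, 1; rewrite E1; split; [exact: oner_neq0 | exact: mulr1].
have Ex : fun_x d F = subfun_of_poly iota d f 'X%:P.
  by rewrite /subfun_of_poly map_polyC /= map_polyX.
have Ey : fun_y d F = subfun_of_poly iota d f 'X.
  by rewrite /subfun_of_poly map_polyX.
rewrite Ex in Px; rewrite Ey in Py.
have [a Pa] := Prat _ (over _) Px; have [b Pb] := Prat _ (over _) Py.
by exists a, b; split; [rewrite Ex; exact: Pa | rewrite Ey; exact: Pb].
Qed.

End SubfieldCurve.

Section Translate.
Variables (k : fieldType) (L : comUnitRingType).
Variables (j : {rmorphism {poly {poly k}} -> L}) (cst : k -> L).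
Hypothesis cstE : forall c, cst c = j c%:P%:P.
Variable R : place cst.

Lemma centered_at_value a b p c :
  centered_at j R a b -> pt_eval a b p = c -> value_at R (j p) c.
Proof.
move=> Rab ep; rewrite /value_at cstE -(rmorphB j); apply: Rab.
by rewrite pt_eval_is_zmod_morphism ep pt_evalC hornerC subrr.
Qed.

Lemma regular_translate_x a : ord_ge R 0 (j ('X - a%:P)%:P) -> ord_ge R 0 (j 'X%:P).
Proof.
have -> : j 'X%:P = j ('X - a%:P)%:P + cst a by rewrite cstE -(rmorphD j) -polyCD subrK.
by move=> Rx; apply: ord_geD => //; apply: ord_ge_cst cstE R a.
Qed.

Lemma regular_scale_y c : c != 0 -> ord_ge R 0 (j (c%:P%:P * 'X)) -> ord_ge R 0 (j 'X).
Proof.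
move=> c0 Ry; have -> : j 'X = cst c^-1 * j (c%:P%:P * 'X).
  by rewrite cstE -(rmorphM j) mulrA -!polyCM mulVf // mul1r.
by rewrite -[0]addr0; apply: ord_geM Ry; apply: ord_ge_cst cstE R _.
Qed.

End Translate.

Section TorsionCurve.
Variables (K : closedFieldType) (n d : nat).
Hypotheses (hd : (2 <= d < n)%N) (hnd : coprime n d) (d_neq0 : d%:R != 0 :> K).
Variables (K0 : fieldType) (iota : {rmorphism K0 -> K}).

Let d_gt1 : (1 < d)%N. Proof. by case/andP: hd. Qed.

Lemma torsion_curve_order (ft : {poly K0}) (Ot Q : point d (map_poly iota ft)) :
    size ft = n.+1 -> separable_poly ft -> torsion_form n d ft ->
    at_infinity Ot -> is_affine_point Q 0 1 ->
  has_order (abel_jacobi Ot Q) (m0 n d).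
Proof.
move=> sft sepft [B [w [[B0 sw _ w0 Eft] _]]] Ot_inf Q01.
have iB0 : iota B != 0 by rewrite fmorph_eq0.
have siw : size (map_poly iota w) = (ell0 n d).+1 by rewrite size_map_poly.
have iw0 : (map_poly iota w).[0] = 1 by rewrite -(rmorph0 iota) horner_map /= w0 rmorph1.
have EF : map_poly iota ft =
    - (iota B ^+ d *: 'X^(m0 n d)) + map_poly iota w ^+ d.
  by rewrite Eft rmorphD rmorphN /= map_polyZ /= map_polyXn !rmorphXn.
have Qc := affine_point_centered Q01.
have M := subfield_model hd hnd iota sft.
have smooth := subfield_smooth (iota := iota) sepft.
exact: (torsion_form_order M (cst := fun_cst d (map_poly iota ft)) (fun _ => erefl) hd hnd
  (subfield_size iota sft) d_neq0 smooth Ot_inf Qc iB0 siw iw0 EF).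
Qed.

Variables (f : {poly K0}) (O P : point d (map_poly iota f)).
Hypotheses (sf : size f = n.+1) (sepf : separable_poly f).
Hypotheses (O_inf : at_infinity O) (P_rat : rational_point P).

(** Order m0 excludes P = O, which has order 1, and b = 0, since then d (P - O) would be principal
    with d < m0. The form of F from [principal_m0_form] is then descended and moved to (0, 1). *)
Lemma order_torsion_form : has_order (abel_jacobi O P) (m0 n d) ->
  exists ft : {poly K0},
    [/\ size ft = n.+1, separable_poly ft, torsion_form n d ft &
        isomorphic_to_01 ft O P].
Proof.
have M := subfield_model hd hnd iota sf.
have sF := subfield_size iota sf.
have smooth := subfield_smooth (iota := iota) sepf.
have cstE c : fun_cst d (map_poly iota f) c =
  (fun_of_poly d (map_poly iota f) : {rmorphism _ -> funfield d (map_poly iota f)}) c%:P%:P by [].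
have [n_m m_nd] := m0_bounds hd hnd; have [_ d_n] := andP hd.
have L_unit := model_unit M.
move=> /(has_order_principal O P _ L_unit)[m_gt0 Pm min_m].
have P_aff : ~ at_infinity P.
  move=> P_inf.
  have cop : coprime (size (map_poly iota f)).-1 d by rewrite sF.
  have PO : P = O := infinity_uniq M cstE d_gt1 cop P_inf O_inf.
  apply: (min_m 1%N); first by rewrite (leq_ltn_trans _ n_m) // (leq_trans _ d_n).
  rewrite PO; exists 1 => [|R]; first exact: oner_neq0.
  by rewrite subrr ord_one.
have [a [b Pab]] := rational_affine_point P_rat P_aff.
have Pc := affine_point_centered Pab.
have Pd : ~ principal_mult O P d.
  by apply: min_m; rewrite (ltnW d_gt1) (ltn_trans d_n).
have ab := centered_curve_eq M cstE hd Pc.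
have [b0 [v [sv va EF]]] :=
  principal_m0_form M cstE hd hnd sF d_neq0 smooth O_inf Pc Pm Pd.
rewrite fmorph_eq0 in b0.
have d0 : d%:R != 0 :> K0 by rewrite -(fmorph_eq0 iota) rmorph_nat.
have ab0 : b ^+ d = f.[a].
  by apply: (fmorph_inj iota); rewrite rmorphXn /= ab horner_map.
exists ((b ^+ d)^-1 *: (f \Po ('X + a%:P))); split.
- by rewrite size_scale ?invr_eq0 ?expf_neq0 // size_comp_XaddC.
- have sep_comp : separable_poly (f \Po ('X + a%:P)).
    move: sepf; rewrite unlock => cop; rewrite deriv_comp derivD derivX derivC addr0 mulr1.
    exact: coprimep_comp_poly.
  have bd0 : (b ^+ d)^-1 != 0 by rewrite invr_eq0 expf_neq0.
  by rewrite (eqp_separable (eqp_scale _ bd0)).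
- exact: torsion_form_descent hd hnd d0 sf b0 ab0 sv va EF.
have cop0 : coprime (size f).-1 d by rewrite sf.
have [phi [phi_x phi_y]] := @curve_iso_translation K0 K iota d f a b d_gt1 cop0 b0.
have ib0 : (iota b)^-1 != 0 by rewrite invr_eq0 fmorph_eq0.
exists phi; split; last split.
- move=> [Rx Ry]; apply: O_inf.
  have Ox : regular_at O (fun_of_poly d (map_poly iota f) ('X - (iota a)%:P)%:P).
    rewrite -phi_x; exact: (regular_at_push (comorph_bij phi) (comorph_cst phi) O _).1 Rx.
  have Oy : regular_at O (fun_of_poly d (map_poly iota f) ((iota b)^-1%:P%:P * 'X)).
    rewrite -phi_y; exact: (regular_at_push (comorph_bij phi) (comorph_cst phi) O _).1 Ry.
  by split; [exact: (regular_translate_x cstE Ox) | exact: (regular_scale_y cstE ib0 Oy)].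
- apply: (value_at_push (comorph_bij phi) (comorph_cst phi) P _ _).2.
  rewrite /fun_x phi_x; apply: (centered_at_value cstE Pc).
  by rewrite pt_evalC !hornerE subrr.
apply: (value_at_push (comorph_bij phi) (comorph_cst phi) P _ _).2.
rewrite /fun_y phi_y; apply: (centered_at_value cstE Pc).
by rewrite /pt_eval !hornerE mulVf // fmorph_eq0.
Qed.

End TorsionCurve.

Theorem theorem2 (K : closedFieldType) (n d : nat)
    (hd : (2 <= d < n)%N) (hnd : coprime n d)
    (hchar : forall p : nat, p \in [pchar K] -> ~~ (p %| d)%N)
    (hm0 : (m0 n d <= n + ell0 n d)%N)
    (K0 : fieldType) (iota : {rmorphism K0 -> K}) (hK0 : perfect_field K0)
    (f : {poly K0}) (hfdeg : size f = n.+1) (hfsep : separable_poly f)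
    (O P : point d (map_poly iota f))
    (hO : at_infinity O) (hP : rational_point P) :
  (has_order (abel_jacobi O P) (m0 n d) <->
   exists ft : {poly K0},
     [/\ size ft = n.+1, separable_poly ft, torsion_form n d ft &
         isomorphic_to_01 ft O P]) /\
  (forall ft : {poly K0},
     size ft = n.+1 -> separable_poly ft -> torsion_form n d ft ->
     isomorphic_to_01 ft O P ->
     forall Ot Q : point d (map_poly iota ft),
       at_infinity Ot -> is_affine_point Q 0 1 ->
       rational_point Q /\ has_order (abel_jacobi Ot Q) (m0 n d)).
Proof.
have d_gt1 : (1 < d)%N by case/andP: hd.
have d_neq0 : d%:R != 0 :> K by apply: natr_neq0_pchar hchar; apply: ltnW.
have M := subfield_model hd hnd iota hfdeg.
split; first split.
- by move=> Pm; have := order_torsion_form hd hnd d_neq0 hfdeg hfsep hO hP Pm.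
- move=> [ft [sft sepft form [phi [phiO phiP]]]].
  have Mt := subfield_model hd hnd iota sft.
  have := torsion_curve_order hd hnd d_neq0 sft sepft form phiO phiP.
  move=> /(has_order_principal _ _ _ (model_unit Mt))[m_gt0 Pm min_m].
  (* The order of (0, 1) is pulled back along the isomorphism. *)
  apply: (has_order_principal O P (m0 n d) (model_unit M)).2.
  split; first exact: m_gt0.
    exact: (principal_mult_push (comorph_bij phi) (comorph_cst phi) O P _).1 Pm.
  move=> i im Pi; apply: (min_m i im).
  exact: (principal_mult_push (comorph_bij phi) (comorph_cst phi) O P _).2 Pi.
move=> ft sft sepft form [phi [phiO phiP]] Ot Q Ot_inf Q01; split; last first.
  by have := torsion_curve_order hd hnd d_neq0 sft sepft form Ot_inf Q01.
have Mt := subfield_model hd hnd iota sft.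
have smooth := subfield_smooth (iota := iota) sepft.
(* Only one place is centered at (0, 1), so Q is the image of P and inherits its rationality. *)
have QE : Q = on_points phi P.
  have Qc := affine_point_centered Q01; have Pc := affine_point_centered phiP.
  have ab := centered_curve_eq Mt (fun _ => erefl) hd Qc.
  apply: (affine_place_uniq Mt (fun _ => erefl) d_gt1 d_neq0 ab _ Qc Pc).
  by move=> /eqP; rewrite (negPf (oner_neq0 K)).
rewrite QE => h h_over h_reg.
have [|c Pc] := hP (comorph phi h) ((comorph_over phi h).2 h_over).
  exact: (regular_at_push (comorph_bij phi) (comorph_cst phi) P h).1 h_reg.
exists c; exact: (value_at_push (comorph_bij phi) (comorph_cst phi) P h (iota c)).2 Pc.
Qed.
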